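(* Let $d$ and $z$ be positive integers, and let $\mathcal{D}_d$ be any nonempty subset of $S_d$ closed under linear changes of coordinates. If there exists an integer $r\geq 0$ such that $$\frac{\dim(S_{d+r+1})}{\dim(S_{r+1})}+\dim(S_{r+1}) \leq z \leq \frac{\dim(S_{d+r})}{\dim(S_r)}-\dim(S_r),$$ then the Hilbert series of the ideal generated by $z$ generic forms from $\mathcal{D}_d$ is given by $$HS_{(\mathcal{D}_d,z)}(t)=\sum_{k=0}^\infty \min\bigl(z\cdot \dim(S_k),\dim(S_{d+k})\bigr)\,t^{d+k}=\frac{1}{(1-t)^n}-\left[ \frac{(1-t^d)^z}{(1-t)^n}\right].$$
   Context: $\mathbb{K}$ is an algebraically closed field of characteristic zero, and $S=\mathbb{K}[x_1,\ldots,x_n]$ is the polynomial ring in $n$ variables; $n$ and $\mathbb{K}$ are fixed. $S_m$ denotes the $m$-th graded component of $S$, i.e. the linear space of all homogeneous polynomials (forms) of degree $m$ in $n$ variables. Examples of $\mathcal{D}_d$ are $\mathcal{D}_d=S_d$ and the set of all $d$-th powers of linear forms. $HF_{(\mathcal{D}_d,z)}(m)$ denotes the dimension of the $m$-th graded component of an ideal of $S$ generated by $z$ generic forms from $\mathcal{D}_d$, and $HS_{(\mathcal{D}_d,z)}(t)=\sum_m HF_{(\mathcal{D}_d,z)}(m)\,t^m$ is the Hilbert series of this ideal (not of the quotient algebra). The brackets $[\,\cdot\,]$ mean that a real formal power series is truncated at its first negative term.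
   Formalization: The set D_d is required to contain a nonzero form rather than merely be nonempty, since the claim fails for D_d = {0}; ''generic'' means on some nonempty relatively Zariski-open subset of z-tuples from D_d. *)

(* Defs.v *)
From Stdlib Require Import Classical ClassicalEpsilon.
From HB Require Import structures.
From mathcomp Require Import all_boot all_order all_algebra.
From mathcomp Require Export mpoly.

Set Implicit Arguments.
Unset Strict Implicit.
Unset Printing Implicit Defensive.

Import Order.TTheory GRing.Theory Num.Theory.
Local Open Scope ring_scope.

(* The number of variables is written [n.+1], because multinomials equips
   [dhomog _ K m], the space S_m of forms of degree m (zero included), with its
   vector space structure only when there is at least one variable. *)

Definition dimS (K : fieldType) (n m : nat) : nat :=
  \dim {: dhomog n.+1 K m}.

Definition lin_subst (K : fieldType) (n : nat) (A : 'M[K]_n) (p : {mpoly K[n]}) :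
    {mpoly K[n]} :=
  p \mPo [tuple \sum_(j < n) A i j *: 'X_j | i < n].

Lemma lin_subst_homog (K : fieldType) (n d : nat) (A : 'M[K]_n) (f : dhomog n K d) :
  lin_subst A (val f) \is d.-homog.
Proof.
case: f => p /= hp; rewrite /lin_subst comp_mpolyE big_seq; apply: rpred_sum => m mp.
apply: rpredZ; have <- : mdeg m = d by apply: dhomog_mf hp m mp.
rewrite mdegE; apply: (big_ind2 (fun q (e : nat) => q \is e.-homog)).
- exact: dhomog1.
- by move=> p1 e1 p2 e2; exact: dhomogM.
move=> i _; rewrite -[X in X.-homog]mul1n tnth_mktuple; apply: dhomogMn.
by apply: rpred_sum => j _; apply: rpredZ; rewrite dhomogX; apply/eqP; exact: mdeg1.
Qed.

Definition lin_change (K : fieldType) (n d : nat) (A : 'M[K]_n) (f : dhomog n K d) :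
    dhomog n K d :=
  DHomog (lin_subst_homog A f).

Definition closed_lin_change (K : fieldType) (n d : nat) (D : dhomog n K d -> Prop) :
    Prop :=
  forall (A : 'M[K]_n) (f : dhomog n K d),
    A \in unitmx -> D f -> D (lin_change A f).

Definition in_ideal (K : fieldType) (n z : nat) (f : 'I_z -> {mpoly K[n]})
    (p : {mpoly K[n]}) : Prop :=
  exists q : 'I_z -> {mpoly K[n]}, p = \sum_(i < z) q i * f i.

Lemma exists_vspace (K : fieldType) (vT : vectType K) (P : vT -> Prop) :
  P 0 -> (forall a u v, P u -> P v -> P (a *: u + v)) ->
  exists V : {vspace vT}, forall v, v \in V <-> P v.
Proof.
move=> P0 PD.
suff H k (V : {vspace vT}) : (\dim {: vT} - \dim V <= k)%N ->
    (forall v, v \in V -> P v) -> exists V : {vspace vT}, forall v, v \in V <-> P v.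
  apply: (H _ 0%VS (leqnn _)) => v; rewrite memv0 => /eqP ->; exact: P0.
elim: k V => [|k IHk] V leVk VP;
  (case: (classic (forall v, P v -> v \in V)) => [PV|];
    first by exists V => v; split; [apply: VP | apply: PV]);
  move=> /not_all_ex_not [v /(imply_to_and (P v)) [Pv /negP vV]];
  have ltV : (\dim V < \dim (V + <[v]>)%VS)%N by
    rewrite (ltn_leqif (dimv_leqif_sup (addvSl _ _))) subv_add subvv -memvE.
- have := leq_trans ltV (dimvS (subvf _)).
  by rewrite ltnNge -subn_eq0 -leqn0 leVk.
- apply: (IHk (V + <[v]>)%VS).
    by rewrite -ltnS; apply: leq_trans leVk; rewrite ltn_sub2l //;
       apply: leq_trans ltV (dimvS (subvf _)).
  move=> w /memv_addP [u uV [w' /vlineP [a ->] ->]].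
  by rewrite addrC; apply: PD => //; apply: VP.
Qed.

Lemma exists_ideal_comp (K : fieldType) (n z : nat) (f : 'I_z -> {mpoly K[n.+1]})
    (m : nat) :
  exists V : {vspace dhomog n.+1 K m},
    forall p : dhomog n.+1 K m, p \in V <-> in_ideal f (val p).
Proof.
apply: exists_vspace => [|a u v [q hq] [r hr]].
  by exists (fun=> 0); rewrite linear0 big1 // => i _; rewrite mul0r.
exists (fun i => a *: q i + r i); rewrite linearP /= hq hr.
rewrite scaler_sumr -big_split; apply: eq_bigr => i _.
by rewrite mulrDl scalerAl.
Qed.

Definition ideal_comp (K : fieldType) (n z : nat) (f : 'I_z -> {mpoly K[n.+1]})
    (m : nat) : {vspace dhomog n.+1 K m} :=
  proj1_sig (constructive_indefinite_description _ (exists_ideal_comp f m)).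

Lemma mem_ideal_comp (K : fieldType) (n z : nat) (f : 'I_z -> {mpoly K[n.+1]})
    (m : nat) (p : dhomog n.+1 K m) :
  p \in ideal_comp f m <-> in_ideal f (val p).
Proof. by rewrite /ideal_comp; case: constructive_indefinite_description. Qed.

Definition HF (K : fieldType) (n z : nat) (f : 'I_z -> {mpoly K[n.+1]}) (m : nat) : nat :=
  \dim (ideal_comp f m).

Definition series (R : Type) : Type := nat -> R.

Definition HS (K : fieldType) (n z : nat) (f : 'I_z -> {mpoly K[n.+1]}) : series rat :=
  fun m => (HF f m)%:R.

(* The series t^d * (\sum_k a_k t^k). *)
Definition shift (R : nmodType) (d : nat) (a : series R) : series R :=
  fun m => if (m < d)%N then 0 else a (m - d)%N.

Fixpoint expansion_seq (R : fieldType) (p q : {poly R}) (m : nat) : seq R :=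
  if m is m'.+1 then
    let s := expansion_seq p q m' in
    rcons s ((p`_m' - \sum_(i < m') q`_(m' - i) * s`_i) / q`_0)
  else [::].

(* The power series expansion of the rational function p / q, for q`_0 != 0;
   it is characterized by [expansionP]. *)
Definition expansion (R : fieldType) (p q : {poly R}) : series R :=
  fun m => (expansion_seq p q m.+1)`_m.

Lemma expansionP (R : fieldType) (p q : {poly R}) (m : nat) : q`_0 != 0 ->
  \sum_(i < m.+1) q`_(m - i) * expansion p q i = p`_m.
Proof.
move=> q0.
have sz k : size (expansion_seq p q k) = k.
  by elim: k => //= k IHk; rewrite size_rcons IHk.
have nthE k i : (i < k)%N -> (expansion_seq p q k)`_i = expansion p q i.
  elim: k => // k IHk; rewrite ltnS leq_eqVlt => /predU1P [->//|ik].
  by rewrite /= nth_rcons sz ik IHk.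
rewrite big_ord_recr /= subnn {2}/expansion /= nth_rcons sz ltnn eqxx.
rewrite mulrCA divff // mulr1 addrC.
rewrite [X in _ + X](_ : _ = \sum_(i < m) q`_(m - i) * (expansion_seq p q m)`_i).
  by rewrite subrK.
by apply: eq_bigr => i _; rewrite nthE.
Qed.

(* [a] cut off just before its first negative term. *)
Definition truncate (R : numDomainType) (a : series R) : series R :=
  fun m => if [forall i : 'I_m.+1, 0 <= a i] then a m else 0.

(* Polynomial functions on a finite dimensional space are the polynomials in the
   coordinates of a basis; the topology does not depend on the basis. *)
Definition zariski_closed (K : fieldType) (vT : vectType K) (Z : vT -> Prop) : Prop :=
  exists I : {mpoly K[\dim {: vT}]} -> Prop,
    forall v, Z v <-> forall P, I P -> P.@[fun i => coord (vbasis {: vT}) i v] = 0.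

Definition zariski_open (K : fieldType) (vT : vectType K) (U : vT -> Prop) : Prop :=
  zariski_closed (fun v => ~ U v).

(* D^z carries the topology induced by the Zariski topology of (S_d)^z, and
   "z generic elements of D satisfy P" means that P holds on some nonempty open
   subset of D^z. *)
Definition generic_forms (K : fieldType) (n d z : nat) (D : dhomog n.+1 K d -> Prop)
    (P : {ffun 'I_z -> dhomog n.+1 K d} -> Prop) : Prop :=
  exists U : {ffun 'I_z -> dhomog n.+1 K d} -> Prop,
    [/\ zariski_open U,
        exists f : {ffun 'I_z -> dhomog n.+1 K d}, (forall i, D (f i)) /\ U f
      & forall f : {ffun 'I_z -> dhomog n.+1 K d}, (forall i, D (f i)) -> U f -> P f].

(* Main.v *)
Require Import Defs.
From Stdlib Require Import Classical ClassicalEpsilon.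
From HB Require Import structures.
From mathcomp Require Import all_boot all_order all_algebra.
From mathcomp Require Import zify ring.

(* Fix a nonzero f in D and consider forms g_i in its orbit under substitutions
   by n x n matrices. In degree d + k let b_j be the dimension of the span of
   S_k g_1 + ... + S_k g_j for generic g_i, and s = dim S_k, N = dim S_{d+k}.
   The increments a_j = b_{j+1} - b_j decrease from at most s, and the crucial
   point is that they decrease strictly as long as 0 < a_j < s; so once an
   increment drops below s, fewer than s further forms fill S_{d+k}. If
   z s + s^2 <= N, such a drop before step z would give N < z s + s^2, so b_z = z s;
   if N + s^2 <= z s, then b_z = N by the same count.

   Strict decrease: let a_{p+1} = a_p < s, and for a set J of p indices not
   containing i let K(i, J) be the space of h in S_k with h g_i in the span of the
   S_k g_j, j in J. Enlarging J by one index keeps the dimension of K(i, J), hence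
   by exchange K(i, J) = K(i) does not depend on J. A relation
   h g_i = sum_J h_j g_j with h in K(i) has all h_j in K(j), so for p + 1 indices
   Q the space M = sum_Q K(i) g_i is the same for every generic Q. Therefore M is
   invariant under GL_n, and it is nonzero, so M = S_{d+k} by irreducibility in
   characteristic 0. But M lies in the span of S_k g_j for j in any p elements of
   Q, whence b_p = N.

   Injectivity in degree d + r passes to lower degrees and surjectivity in degree
   d + r + 1 to higher ones. In particular dim S_{r+1} < z <= dim S_d, so
   r + 1 < d, and up to degree d + r + 1 < 2d the power (1 - t^d)^z may be
   replaced by 1 - z t^d. *)

Set Implicit Arguments.
Unset Strict Implicit.
Unset Printing Implicit Defensive.

Import Order.TTheory GRing.Theory Num.Theory.
Local Open Scope ring_scope.

(** * Generic points on lines *)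

Definition polyfun (K : fieldType) (G : K -> K) : Prop :=
  exists P : {poly K}, forall t, G t = P.[t].

Section PolyFun.
Variable K : fieldType.
Implicit Types (G : K -> K) (c : K).

Lemma polyfun_const c : polyfun (fun=> c).
Proof. by exists c%:P => t; rewrite hornerC. Qed.

Lemma polyfunM G1 G2 :
  polyfun G1 -> polyfun G2 -> polyfun (fun t => G1 t * G2 t).
Proof. by move=> [P hP] [Q hQ]; exists (P * Q) => t; rewrite hornerM hP hQ. Qed.

Lemma polyfun_sum (I : Type) (s : seq I) (P : pred I) (G : I -> K -> K) :
  (forall i, polyfun (G i)) -> polyfun (fun t => \sum_(i <- s | P i) G i t).
Proof.
move=> hG; elim: s => [|i s [Q hQ]].
  by exists 0 => t; rewrite big_nil horner0.
have [R hR] := hG i; exists (if P i then R + Q else Q) => t.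
by rewrite big_cons; case: ifP; rewrite ?hornerD hQ ?hR.
Qed.

Lemma polyfun_prod (I : Type) (s : seq I) (P : pred I) (G : I -> K -> K) :
  (forall i, polyfun (G i)) -> polyfun (fun t => \prod_(i <- s | P i) G i t).
Proof.
move=> hG; elim: s => [|i s [Q hQ]].
  by exists 1 => t; rewrite big_nil hornerC.
have [R hR] := hG i; exists (if P i then R * Q else Q) => t.
by rewrite big_cons; case: ifP; rewrite ?hornerM hQ ?hR.
Qed.

Lemma polyfun_det r (M : K -> 'M[K]_r) :
  (forall a b, polyfun (fun t => M t a b)) -> polyfun (fun t => \det (M t)).
Proof.
move=> hM; apply: polyfun_sum => s; apply: polyfunM; first exact: polyfun_const.
by apply: polyfun_prod => i; apply: hM.
Qed.

End PolyFun.

(* Over an infinite field, the sets that meet every line through each of their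
   points in a cofinite subset behave like Zariski open sets, but only
   polynomials in one variable are needed to work with them. *)
Definition line_open (K : fieldType) (V : lmodType K) (U : V -> Prop) : Prop :=
  forall x v, U x -> exists2 P : {poly K}, P != 0 &
    forall t, ~~ root P t -> U (x + t *: v).

Section LineOpen.
Variable K : closedFieldType.

Lemma line_open_meet (V : lmodType K) (U1 U2 : V -> Prop) :
  line_open U1 -> line_open U2 -> (exists x, U1 x) -> (exists x, U2 x) ->
  exists x, U1 x /\ U2 x.
Proof.
move=> o1 o2 [x Ux] [y Uy].
have [P P0 hP] := o1 x (y - x) Ux; have [Q Q0 hQ] := o2 y (x - y) Uy.
have Q'0 : Q \Po (1 - 'X) != 0.
  by rewrite comp_poly2_eq0 // -opprB size_polyN -['X - 1]/('X - 1%:P) size_XsubC.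
have /closed_nonrootP [t] : P * (Q \Po (1 - 'X)) != 0 by rewrite mulf_neq0.
rewrite rootM negb_or root_comp hornerD hornerN hornerX hornerC => /andP [ht1 ht2].
exists (x + t *: (y - x)); split; first exact: hP.
suff -> : x + t *: (y - x) = y + (1 - t) *: (x - y) by apply: hQ.
by rewrite scalerBl scale1r addrA subrKC -scalerN opprB.
Qed.

Lemma line_openI (V : lmodType K) (U1 U2 : V -> Prop) :
  line_open U1 -> line_open U2 -> line_open (fun x => U1 x /\ U2 x).
Proof.
move=> o1 o2 x v [Ux1 Ux2].
have [P P0 hP] := o1 x v Ux1; have [Q Q0 hQ] := o2 x v Ux2.
exists (P * Q); first by rewrite mulf_neq0.
by move=> t; rewrite rootM negb_or => /andP [? ?]; split; [apply: hP | apply: hQ].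
Qed.

Lemma line_open_all (V : lmodType K) (I : finType) (U : I -> V -> Prop) :
  (forall i, line_open (U i)) -> line_open (fun x => forall i, U i x).
Proof.
move=> oU x v Ux.
have /fin_all_exists2 [P P0 hP] i : exists2 P : {poly K}, P != 0 &
    forall t, ~~ root P t -> U i (x + t *: v) by apply: oU.
exists (\prod_i P i); first by apply/prodf_neq0 => i _; apply: P0.
move=> t; rewrite /root horner_prod => /prodf_neq0 nz i.
by apply: hP; apply: nz.
Qed.

Lemma line_open_meet_all (V : lmodType K) (I : finType) (U : I -> V -> Prop) :
  (forall i, line_open (U i)) -> (forall i, exists x, U i x) ->
  exists x, forall i, U i x.
Proof.
move=> oU nU.
have H (s : seq I) : exists x, forall i : I, i \in s -> U i x.
  elim: s => [|i s IHs]; first by exists 0.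
  pose W x := forall j : I, j \in s -> U j x.
  have oW : line_open W.
    have := @line_open_all V I (fun j x => j \in s -> U j x); apply=> j y w Uy.
    case: (boolP (j \in s)) => js; last first.
      by exists 1 => [|t _]; rewrite ?oner_eq0.
    by have [P P0 hP] := oU j y w (Uy js); exists P => // t ht _; apply: hP.
  have [x [Ux Wx]] := line_open_meet (oU i) oW (nU i) IHs.
  by exists x => j; rewrite inE => /predU1P [->|/Wx].
have [x Hx] := H (enum I); exists x => i; apply: Hx; exact: mem_enum.
Qed.

Lemma line_open_affine (V V' : lmodType K) (g l : V -> V') (U : V' -> Prop) :
  (forall x t v, g (x + t *: v) = g x + t *: l v) ->
  line_open U -> line_open (fun x => U (g x)).
Proof.
move=> hg oU x v Ux; have [P P0 hP] := oU _ (l v) Ux.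
by exists P => // t ht; rewrite hg; apply: hP.
Qed.

Lemma line_open_neq0 (V : lmodType K) (F : V -> K) :
  (forall x v, polyfun (fun t => F (x + t *: v))) -> line_open (fun x => F x != 0).
Proof.
move=> hF x v nz; have [P hP] := hF x v; exists P => [|t]; last by rewrite hP.
by apply: contra nz => /eqP P0; rewrite -[x]addr0 -(scale0r v) hP P0 horner0.
Qed.

End LineOpen.

Lemma dim_minor (K : fieldType) (vT : vectType K) (V : {vspace vT}) (r : nat) :
  (r <= \dim V)%N <-> exists x : 'I_r -> vT, exists w : 'I_r -> 'Hom(vT, K^o),
    (forall a, x a \in V) /\ \det (\matrix_(a, b) (w b (x a) : K)) != 0.
Proof.
split=> [le_rV | [x [w [xV nz]]]].
  exists (fun a => (vbasis V)`_(widen_ord le_rV a)).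
  exists (fun b => linfun (coord (vbasis V) (widen_ord le_rV b) : vT -> K^o)).
  split=> [a|]; first by apply: vbasis_mem; rewrite mem_nth // size_tuple.
  rewrite [X in \det X](_ : _ = 1%:M) ?det1 ?oner_eq0 //.
  apply/matrixP => a b; rewrite !mxE lfunE.
  by rewrite /= (coord_free (widen_ord le_rV a)) ?(basis_free (vbasisP V)) // -val_eqE.
rewrite leqNgt; apply/negP => lt_Vr.
pose X := [tuple x a | a < r].
have : ~~ free X.
  apply: contraL lt_Vr; rewrite -leqNgt /free size_tuple => /eqP <-.
  by apply: dimvS; apply/span_subvP => _ /mapP [a _ ->].
move=> nfX.
have [k [j kj kX]] : exists k : 'I_r -> K, exists2 j, k j != 0 & \sum_a k a *: x a = 0.
  apply: NNPP => nk.
  move/negP: nfX; apply.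
  apply/freeP => k hk j; apply/eqP/negPn/negP => kj; apply: nk; exists k; exists j => //.
  by apply: etrans hk; apply: eq_bigr => a _; rewrite -tnth_nth tnth_mktuple.
have M0 : (\row_a k a) *m (\matrix_(a, b) (w b (x a) : K)) = 0.
  apply/rowP => b; rewrite !mxE.
  transitivity (w b (\sum_a k a *: x a)); last by rewrite kX linear0.
  by rewrite linear_sum; apply: eq_bigr => a _; rewrite !mxE linearZ.
have uM : \matrix_(a, b) (w b (x a) : K) \in unitmx by rewrite unitmxE unitfE.
have : \row_a k a = 0 by rewrite -[LHS](mulmxK uM) M0 mul0mx.
by move/rowP/(_ j); rewrite !mxE => k0; rewrite k0 eqxx in kj.
Qed.

(** * Linear substitutions *)

Lemma lin_subst_is_linear (K : fieldType) (n : nat) (A : 'M[K]_n) :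
  linear (lin_subst A).
Proof. by move=> c p q; rewrite /lin_subst comp_mpolyD comp_mpolyZ. Qed.

Lemma lin_subst_is_multiplicative (K : fieldType) (n : nat) (A : 'M[K]_n) :
  multiplicative (lin_subst A).
Proof. exact: comp_mpoly_is_multiplicative. Qed.

HB.instance Definition _ (K : fieldType) (n : nat) (A : 'M[K]_n) :=
  GRing.isLinear.Build K {mpoly K[n]} {mpoly K[n]} _ (lin_subst A)
    (@lin_subst_is_linear K n A).

HB.instance Definition _ (K : fieldType) (n : nat) (A : 'M[K]_n) :=
  GRing.isMultiplicative.Build {mpoly K[n]} {mpoly K[n]} (lin_subst A)
    (@lin_subst_is_multiplicative K n A).

Section LinSubst.
Variables (K : fieldType) (n : nat).
Implicit Types (p q : {mpoly K[n]}) (A B : 'M[K]_n).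

Lemma lin_substX A (a : 'X_{1..n}) :
  lin_subst A 'X_[a] = \prod_i (\sum_j A i j *: 'X_j) ^+ a i.
Proof. by rewrite /lin_subst comp_mpolyX; apply: eq_bigr => i _; rewrite tnth_mktuple. Qed.

Lemma lin_substXU A i : lin_subst A 'X_i = \sum_j A i j *: 'X_j.
Proof. by rewrite /lin_subst comp_mpolyXU -tnth_nth tnth_mktuple. Qed.

Lemma lin_substM A p q : lin_subst A (p * q) = lin_subst A p * lin_subst A q.
Proof. exact: rmorphM. Qed.

Lemma lin_substE A p :
  lin_subst A p = \sum_(a <- msupp p) p@_a *: lin_subst A 'X_[a].
Proof. exact: comp_mpolyEX. Qed.

Lemma lin_subst_mul A B p : lin_subst B (lin_subst A p) = lin_subst (A *m B) p.
Proof.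
rewrite (lin_substE A p) (lin_substE (A *m B) p) linear_sum.
apply: eq_bigr => a _; rewrite linearZ; congr (_ *: _).
rewrite !lin_substX rmorph_prod.
apply: eq_bigr => i _; rewrite rmorphXn /= linear_sum; congr (_ ^+ _).
rewrite (eq_bigr (fun j => \sum_k (A i j * B j k) *: 'X_k)) => [|j _]; last first.
  rewrite linearZ /= lin_substXU scaler_sumr.
  by apply: eq_bigr => k _; rewrite scalerA.
rewrite exchange_big; apply: eq_bigr => k _.
by rewrite mxE scaler_suml.
Qed.

Lemma lin_subst1 p : lin_subst 1%:M p = p.
Proof.
rewrite -[RHS]comp_mpoly_id /lin_subst; congr (_ \mPo _).
apply: eq_from_tnth => i; rewrite !tnth_mktuple (bigD1 i) //= mxE eqxx scale1r.
by rewrite big1 ?addr0 // => j ji; rewrite mxE eq_sym (negPf ji) scale0r.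
Qed.

Lemma lin_subst_rank1 (c l : 'I_n -> K) p d : p \is d.-homog ->
  lin_subst (\matrix_(i, j) (c i * l j)) p = p.@[c] *: (\sum_j l j *: 'X_j) ^+ d.
Proof.
move=> hp; rewrite lin_substE mevalE scaler_suml big_seq [RHS]big_seq.
apply: eq_bigr => a ap; rewrite -scalerA; congr (_ *: _).
have <- : mdeg a = d by exact: dhomog_mf hp a ap.
rewrite lin_substX mdegE -prodrXr -scaler_prod.
apply: eq_bigr => i _; rewrite -exprZn scaler_sumr; congr (_ ^+ _).
by apply: eq_bigr => j _; rewrite mxE scalerA.
Qed.

Definition poly_curve (G : K -> {mpoly K[n]}) : Prop :=
  exists P : {poly {mpoly K[n]}}, forall t, G t = P.[t%:MP].

Lemma lin_subst_curve A B p : poly_curve (fun t => lin_subst (A + t *: B) p).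
Proof.
pose L i : {poly {mpoly K[n]}} :=
  \sum_j ((A i j)%:MP%:P + (B i j)%:MP *: 'X) * ('X_j)%:P.
exists (\sum_(a <- msupp p) (p@_a)%:MP%:P * \prod_i L i ^+ a i) => t.
rewrite lin_substE horner_sum; apply: eq_bigr => a _.
rewrite hornerM hornerC mul_mpolyC; congr (_ *: _).
rewrite lin_substX horner_prod; apply: eq_bigr => i _.
rewrite horner_exp; congr (_ ^+ _); rewrite horner_sum; apply: eq_bigr => j _.
rewrite hornerM hornerD !hornerC hornerZ hornerX -mul_mpolyC !mxE.
by rewrite mpolyCD mpolyCM [t%:MP * _]mulrC.
Qed.

End LinSubst.

Lemma lin_change_is_linear (K : fieldType) (n d : nat) (A : 'M[K]_n) :
  linear (@lin_change K n d A).
Proof. by move=> c f g; apply: val_inj; rewrite /= !linearP. Qed.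

HB.instance Definition _ (K : fieldType) (n d : nat) (A : 'M[K]_n) :=
  GRing.isLinear.Build K (dhomog n K d) (dhomog n K d) _ (@lin_change K n d A)
    (@lin_change_is_linear K n d A).

Lemma lin_change_mul (K : fieldType) (n d : nat) (A B : 'M[K]_n) (f : dhomog n K d) :
  lin_change B (lin_change A f) = lin_change (A *m B) f.
Proof. by apply: val_inj; rewrite /= lin_subst_mul. Qed.

Lemma lin_change1 (K : fieldType) (n d : nat) (f : dhomog n K d) :
  lin_change 1%:M f = f.
Proof. by apply: val_inj; rewrite /= lin_subst1. Qed.

Lemma dhomog_curve (K : fieldType) (n d : nat) (G : K -> dhomog n K d) :
  poly_curve (fun t => val (G t)) ->
  exists k, exists c : nat -> dhomog n K d, forall t, G t = \sum_(i < k) t ^+ i *: c i.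
Proof.
move=> [P hP]; exists (size P), (fun i => DHomog (pihomogP mdeg d P`_i)) => t.
apply: val_inj; rewrite linear_sum /= -(pihomog_dE (dhomog_is_dhomog (G t))) hP.
rewrite horner_coef linear_sum; apply: eq_bigr => i _.
by rewrite -rmorphXn mulrC mul_mpolyC !linearZ.
Qed.

Lemma polyfun_dhomog (K : fieldType) (n d : nat) (G : K -> dhomog n.+1 K d)
    (w : 'Hom(dhomog n.+1 K d, K^o)) :
  poly_curve (fun t => val (G t)) -> polyfun (fun t => w (G t) : K).
Proof.
move=> /dhomog_curve [k [c hc]]; exists (\sum_(i < k) (w (c i) : K) *: 'X^i) => t.
rewrite hc linear_sum horner_sum; apply: eq_bigr => i _.
by rewrite linearZ hornerZ hornerXn mulrC.
Qed.

Lemma vspace_curve (K : closedFieldType) (vT : vectType K) (V : {vspace vT})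
    (k : nat) (c : nat -> vT) (P : {poly K}) : P != 0 ->
  (forall t, ~~ root P t -> \sum_(i < k) t ^+ i *: c i \in V) ->
  forall i, (i < k)%N -> c i \in V.
Proof.
move=> P0 hV i ik.
pose pi v := v - projv V v.
have pi_lin : linear pi.
  by move=> a u v; rewrite /pi linearP scalerBr opprD addrACA.
pose piL := HB.pack_for {linear vT -> vT} pi (GRing.isLinear.Build _ _ _ _ pi pi_lin).
have memE v : (v \in V) = (pi v == 0).
  rewrite subr_eq0; apply/idP/eqP => [/projv_id //|->]; exact: memv_proj.
rewrite memE; apply/eqP; rewrite [LHS](coord_vbasis (memvf _)) big1 // => j _.
pose Q := \poly_(i < k) coord (vbasis {:vT}) j (pi (c i)).
suff Q0 : Q = 0.
  have := congr1 (fun q : {poly K} => q`_i) Q0.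
  by rewrite coef_poly ik coef0 => ->; rewrite scale0r.
apply: contraTeq isT => Qnz.
have /closed_nonrootP [t] : P * Q != 0 by rewrite mulf_neq0.
rewrite rootM negb_or => /andP [/hV ht /negP []]; rewrite memE in ht.
rewrite /root /Q horner_poly; apply/eqP.
transitivity (coord (vbasis {:vT}) j (piL (\sum_(i < k) t ^+ i *: c i))).
  rewrite !linear_sum; apply: eq_bigr => a _.
  by rewrite linearZ /= [in RHS]linearZ mulrC.
by rewrite (eqP ht : piL _ = 0) linear0.
Qed.

(** * Irreducibility of the space of forms *)

Lemma digits_inj (B n : nat) (a b : 'I_n -> nat) :
  (forall i, a i < B)%N -> (forall i, b i < B)%N ->
  (\sum_(i < n) a i * B ^ i = \sum_(i < n) b i * B ^ i)%N -> a =1 b.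
Proof.
elim: n a b => [|n IHn] a b ha hb; first by move=> _ [].
have shiftE (c : 'I_n.+1 -> nat) : (\sum_(i < n.+1) c i * B ^ i =
    c ord0 + (\sum_(i < n) c (lift ord0 i) * B ^ i) * B)%N.
  rewrite big_ord_recl muln1 big_distrl; congr (_ + _)%N.
  by apply: eq_bigr => i _; rewrite expnSr mulnA.
rewrite !shiftE => e.
have B0 : (0 < B)%N by apply: leq_ltn_trans (ha ord0).
have e0 : a ord0 = b ord0.
  by have := congr1 (modn^~ B) e; rewrite !(addnC _ (_ * B)%N) !modnMDl !modn_small.
have e1 : (\sum_(i < n) a (lift ord0 i) * B ^ i = \sum_(i < n) b (lift ord0 i) * B ^ i)%N.
  by move: e; rewrite e0 => /addnI /eqP; rewrite eqn_pmul2r // => /eqP.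
have := IHn (fun i => a (lift ord0 i)) (fun i => b (lift ord0 i)).
move=> /(_ (fun i => ha _) (fun i => hb _) e1) ab i.
by case: (unliftP ord0 i) => [j|] ->.
Qed.

(* The exponent of t in the monomial x^a after the Kronecker substitution
   x_i := t^(B^i), which separates monomials of degree less than B. *)
Definition kron (B n : nat) (a : 'X_{1..n}) : nat := (\sum_(i < n) a i * B ^ i)%N.

Lemma kron_inj (n d : nat) (a b : 'X_{1..n}) :
  mdeg a = d -> mdeg b = d -> kron d.+1 a = kron d.+1 b -> a = b.
Proof.
have le_mdeg (c : 'X_{1..n}) i : (c i < (mdeg c).+1)%N.
  by rewrite ltnS mdegE (bigD1 i) //= leq_addr.
move=> ha hb e; apply/mnmP; apply: digits_inj e => i; [rewrite -ha | rewrite -hb];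
exact: le_mdeg.
Qed.

Lemma meval_kron (K : fieldType) (n B : nat) (t : K) (a : 'X_{1..n}) :
  \prod_(i < n) (t ^+ (B ^ i)%N) ^+ a i = t ^+ kron B a.
Proof.
rewrite /kron -prodrXr; apply: eq_bigr => i _.
by rewrite -exprM mulnC.
Qed.

Lemma dhomog_meval_neq0 (K : closedFieldType) (n d : nat) (p : {mpoly K[n]}) :
  p \is d.-homog -> p != 0 -> exists c, p.@[c] != 0.
Proof.
move=> hp p0; set a := mlead p.
pose Q : {poly K} := \sum_(b <- msupp p) p@_b *: 'X^(kron d.+1 b).
have Qa : Q`_(kron d.+1 a) = p@_a.
  rewrite coef_sum (bigD1_seq a) ?msupp_uniq ?mlead_supp //= coefZ coefXn eqxx mulr1.
  rewrite big_seq_cond big1 ?addr0 // => b /andP [bp ba].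
  rewrite coefZ coefXn; case: eqP => [e|_]; last by rewrite mulr0.
  case/eqP: ba; apply: kron_inj (esym e); apply: (dhomog_mf hp) => //.
  exact: mlead_supp.
have : Q != 0.
  by apply: contraNneq p0 => Q0; rewrite -mleadc_eq0 -Qa Q0 coef0.
move=> /closed_nonrootP [t ht]; exists (fun i => t ^+ (d.+1 ^ i)%N).
apply: contra ht; rewrite /root horner_sum mevalE => /eqP {2}<-; apply/eqP.
by apply: eq_bigr => b _; rewrite hornerZ hornerXn meval_kron.
Qed.

Lemma exists_content (n d : nat) (a : 'X_{1..n}) : mdeg a = d ->
  exists f : {ffun 'I_d -> 'I_n}, a = (\sum_k U_(f k))%MM.
Proof.
move=> ha; have sz : size (m2s a) == d by rewrite size_m2s ha.
exists [ffun k => tnth (Tuple sz) k]; apply/mnmP => i.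
rewrite -{1}(s2mK a) mnmE mnm_sumE -sum1_count big_mkcond /=.
rewrite -[m2s a]/(val (Tuple sz)) big_tuple; apply: eq_bigr => k _.
by rewrite ffunE mnm1E; case: eqP.
Qed.

Definition monomial (K : fieldType) (n d : nat) (a : 'X_{1..n}) : dhomog n K d :=
  insubd 0 'X_[a].

Lemma val_monomial (K : fieldType) (n d : nat) (a : 'X_{1..n}) :
  mdeg a = d -> val (monomial K d a) = 'X_[a].
Proof.
move=> ha; rewrite val_insubd; suff -> : ('X_[a] : {mpoly K[n]}) \is d.-homog by [].
by rewrite dhomogX; apply/eqP.
Qed.

Lemma dhomog_full (K : fieldType) (n d : nat) (V : {vspace dhomog n.+1 K d}) :
  (forall v : dhomog n.+1 K d, forall a, val v = 'X_[a] -> v \in V) -> V = fullv.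
Proof.
move=> hV; apply/vspaceP => v; rewrite memvf.
suff -> : v = \sum_(a <- msupp (val v)) (val v)@_a *: monomial K d a.
  rewrite big_seq; apply: rpred_sum => a av; apply: memvZ.
  by apply: (hV _ a); apply: val_monomial; apply: (dhomog_mf (dhomog_is_dhomog v)).
apply: val_inj; rewrite linear_sum /= [LHS]mpolyE [LHS]big_seq [RHS]big_seq.
apply: eq_bigr => a av; rewrite /= -[mpoly_of_dhomog _]/(val _) val_monomial //.
exact: (dhomog_mf (dhomog_is_dhomog v)).
Qed.

Section Irreducible.
Variables (K : closedFieldType) (n d : nat) (V : {vspace dhomog n.+1 K d}).
Hypothesis V_inv : forall (A : 'M[K]_n.+1) v,
  A \in unitmx -> v \in V -> lin_change A v \in V.

Lemma inv_lin_change (A : 'M[K]_n.+1) v : v \in V -> lin_change A v \in V.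
Proof.
move=> vV; pose G t := lin_change (1%:M + t *: (A - 1%:M)) v.
have [k [c hc]] : exists k, exists c : nat -> dhomog n.+1 K d,
    forall t, G t = \sum_(i < k) t ^+ i *: c i.
  apply: dhomog_curve; exact: lin_subst_curve.
have [P hP] : polyfun (fun t => \det (1%:M + t *: (A - 1%:M))).
  apply: polyfun_det => a b.
  exists (((1%:M : 'M[K]_n.+1) a b)%:P + ((A - 1%:M) a b) *: 'X) => t.
  by rewrite hornerD hornerZ hornerC hornerX !mxE mulrC.
have P0 : P != 0.
  apply: contraTneq (oner_neq0 K) => P0.
  by rewrite -(det1 K n.+1) -[1%:M]addr0 -(scale0r (A - 1%:M)) hP P0 horner0 eqxx.
have cV : forall i, (i < k)%N -> c i \in V.
  apply: (vspace_curve P0) => t; rewrite /root -hP -hc => ut.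
  by apply: V_inv; rewrite // unitmxE unitfE.
have -> : lin_change A v = G 1 by rewrite /G scale1r addrC subrK.
by rewrite hc; apply: rpred_sum => i _; apply: memvZ; apply: cV.
Qed.

Hypothesis charK : [pchar K] =i pred0.

(* Rank one substitutions produce the d-th powers of all linear forms, and in
   characteristic 0 the expansion of these powers isolates every monomial. *)
Lemma inv_full : V != 0%VS -> V = fullv.
Proof.
move=> V0; set v := vpick V; have vV : v \in V := memv_pick V.
have v0 : val v != 0.
  by rewrite -vpick0 in V0; apply: contra V0 => /eqP v0; apply/eqP/val_inj.
have [x vx] := dhomog_meval_neq0 (dhomog_is_dhomog v) v0.
pose X (f : {ffun 'I_d -> 'I_n.+1}) : dhomog n.+1 K d :=
  monomial K d (\sum_k U_(f k)).
have deg_content (f : {ffun 'I_d -> 'I_n.+1}) : mdeg (\sum_k U_(f k))%MM = d.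
  by rewrite mdeg_sum (eq_bigr (fun=> 1%N)) ?sum1_card ?card_ord // => k _; rewrite mdeg1.
have valX f : val (X f) = 'X_[\sum_k U_(f k)].
  exact: val_monomial.
pose e (f : {ffun 'I_d -> 'I_n.+1}) := kron d.+1 (\sum_k U_(f k))%MM.
pose c i := \sum_(f | e f == i) X f.
pose M := (\max_f e f).+1.
have cV : forall i, (i < M)%N -> c i \in V.
  apply: (vspace_curve (oner_neq0 _)) => t _.
  pose l (j : 'I_n.+1) := t ^+ (d.+1 ^ j).
  have := inv_lin_change (\matrix_(i, j) (x i * l j)) vV.
  suff -> : lin_change (\matrix_(i, j) (x i * l j)) v =
      (val v).@[x] *: \sum_(i < M) t ^+ i *: c i.
    by move/(memvZ (val v).@[x]^-1); rewrite scalerA mulVf // scale1r.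
  apply: val_inj; rewrite /= (lin_subst_rank1 _ _ (dhomog_is_dhomog v)).
  congr (_ *: _); rewrite -[d in LHS]card_ord -prodr_const.
  rewrite bigA_distr_bigA /= linear_sum /=.
  under [RHS]eq_bigr => i _.
    rewrite /c linear_sum /= scaler_sumr.
    under eq_bigr => f /eqP <- do rewrite -[mpoly_of_dhomog _]/(val _) valX.
    over.
  rewrite (exchange_big_dep xpredT) //=; apply: eq_bigr => f _.
  have ef : (e f < M)%N by rewrite ltnS; apply: leq_bigmax.
  rewrite (big_pred1 (Ordinal ef)) => [|i]; last by rewrite /= eq_sym -val_eqE.
  rewrite -mprodXE scaler_prod; congr (_ *: _).
  rewrite -meval_kron -mevalX -mprodXE rmorph_prod.
  by apply: eq_bigr => k _; rewrite /= mevalXU.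
apply: dhomog_full => w a wa.
have [f fE] : exists f : {ffun 'I_d -> 'I_n.+1}, a = (\sum_k U_(f k))%MM.
  apply: exists_content; apply: (dhomog_mf (dhomog_is_dhomog w)).
  by rewrite wa msuppX inE.
have wX : w = X f by apply: val_inj; rewrite wa valX fE.
have cE : c (e f) = X f *+ #|[pred g | e g == e f]|.
  rewrite -sumr_const; apply: eq_bigr => g /eqP ge.
  by apply: val_inj; rewrite !valX (kron_inj (deg_content g) (deg_content f) ge).
have : c (e f) \in V by apply: cV; rewrite ltnS; apply: leq_bigmax.
rewrite cE wX -scaler_nat => /(memvZ (#|[pred g | e g == e f]|%:R)^-1).
rewrite scalerA mulVf ?scale1r //.
have /pcharf0P -> := charK.
by rewrite -lt0n; apply/card_gt0P; exists f; rewrite inE.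
Qed.
End Irreducible.

(** * Spans of multiples of given forms *)

Section FormMul.
Variables (K : fieldType) (n d k : nat).
Implicit Types (g : dhomog n K d) (h : dhomog n K k) (A : 'M[K]_n).

Definition form_mul g h : dhomog n K (d + k) :=
  DHomog (dhomogM (dhomog_is_dhomog g) (dhomog_is_dhomog h)).

Lemma val_form_mul g h : val (form_mul g h) = val g * val h.
Proof. by []. Qed.

Lemma form_mul_is_linear g : linear (form_mul g).
Proof.
by move=> c h1 h2; apply: val_inj; rewrite /= mulrDr scalerAr.
Qed.

HB.instance Definition _ g :=
  GRing.isLinear.Build K (dhomog n K k) (dhomog n K (d + k)) _ (form_mul g)
    (form_mul_is_linear g).

Lemma lin_change_form_mul A g h :
  lin_change A (form_mul g h) = form_mul (lin_change A g) (lin_change A h).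
Proof. by apply: val_inj; rewrite /= lin_substM. Qed.

End FormMul.

Lemma dim_lpreim (K : fieldType) (aT rT : vectType K) (u : 'Hom(aT, rT))
    (V : {vspace rT}) :
  (\dim (u @^-1: V) + \dim (limg u + V) = \dim {:aT} + \dim V)%N.
Proof.
have imE : (u @: (u @^-1: V) = V :&: limg u)%VS.
  by rewrite -lpreim_cap_limg lpreimK // capvSr.
have kerE : ((u @^-1: V) :&: lker u = lker u)%VS.
  by apply/capv_idPr; rewrite -lpreim0 lpreimS // sub0v.
have := limg_ker_dim u (u @^-1: V); rewrite kerE imE.
have := limg_ker_dim u fullv; rewrite capfv.
have := dimv_sum_cap (limg u) V; rewrite capvC; lia.
Qed.

Section FormSpan.
Variables (K : fieldType) (n d k : nat).

Definition mul_lfun (g : dhomog n.+1 K d) :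
    'Hom(dhomog n.+1 K k, dhomog n.+1 K (d + k)) :=
  linfun (form_mul g).

Definition form_span (T : finType) (J : {set T}) (g : T -> dhomog n.+1 K d) :
    {vspace dhomog n.+1 K (d + k)} :=
  (\sum_(i in J) limg (mul_lfun (g i)))%VS.

Variable T : finType.
Implicit Types (J : {set T}) (g : T -> dhomog n.+1 K d).

Lemma form_spanP J g v : reflect
  (exists h : T -> dhomog n.+1 K k, v = \sum_(i in J) form_mul (g i) (h i))
  (v \in form_span J g).
Proof.
apply: (iffP memv_sumP) => [[vs vsP ->]|[h ->]].
  exists (fun i => ((mul_lfun (g i))^-1)%VF (vs i)); apply: eq_bigr => i iJ.
  by rewrite -[form_mul _ _]lfunE -/(mul_lfun _) limg_lfunVK // vsP.
exists (fun i => form_mul (g i) (h i)) => // i _.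
by rewrite -[form_mul _ _]lfunE memv_img ?memvf.
Qed.

Lemma form_span_mul J g i h : i \in J -> form_mul (g i) h \in form_span J g.
Proof.
move=> iJ; rewrite -[form_mul _ _]lfunE -/(mul_lfun _).
by apply: (subvP (sumv_sup i iJ (subvv _))); rewrite memv_img ?memvf.
Qed.

Lemma form_spanS J J' g : J \subset J' -> (form_span J g <= form_span J' g)%VS.
Proof.
move=> JJ'; apply/subv_sumP => i iJ; apply: (sumv_sup i) => //.
exact: (subsetP JJ').
Qed.

Lemma form_span_ext J g g' : {in J, g =1 g'} -> form_span J g = form_span J g'.
Proof. by move=> e; apply: eq_bigr => i iJ; rewrite e. Qed.

Lemma form_spanU1 J g i : i \notin J ->
  form_span (i |: J) g = (limg (mul_lfun (g i)) + form_span J g)%VS.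
Proof. by move=> iJ; rewrite /form_span big_setU1. Qed.

Lemma form_span_enum J g :
  form_span J g = form_span [set: 'I_#|J|] (fun i => g (enum_val i)).
Proof.
rewrite /form_span big_enum_val; apply: eq_bigl => i.
by rewrite in_setT.
Qed.

Lemma dim_form_span J g :
  (\dim (form_span J g) <= #|J| * \dim {: dhomog n.+1 K k})%N.
Proof.
apply: leq_trans (dimv_leq_sum _ _ _) _.
rewrite -sum_nat_const; apply: leq_sum => i _.
by rewrite -(limg_ker_dim (mul_lfun (g i)) fullv) leq_addl.
Qed.

Lemma lin_change_form_span J g A v : v \in form_span J g ->
  lin_change A v \in form_span J (fun i => lin_change A (g i)).
Proof.
case/form_spanP => h ->; rewrite linear_sum; apply/form_spanP.
exists (fun i => lin_change A (h i)); apply: eq_bigr => i _.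
exact: lin_change_form_mul.
Qed.

(* The space K(i, J) of the introduction. *)
Definition syz (i : T) J g : {vspace dhomog n.+1 K k} :=
  (mul_lfun (g i) @^-1: form_span J g)%VS.

Lemma mem_syz i J g h : (h \in syz i J g) = (form_mul (g i) h \in form_span J g).
Proof. by rewrite -memv_preim lfunE. Qed.

Lemma syzS i J J' g : J \subset J' -> (syz i J g <= syz i J' g)%VS.
Proof. by move=> JJ'; apply: lpreimS; apply: form_spanS. Qed.

Lemma dim_syz i J g : i \notin J ->
  (\dim (syz i J g) + \dim (form_span (i |: J) g) =
   \dim {: dhomog n.+1 K k} + \dim (form_span J g))%N.
Proof. by move=> iJ; rewrite form_spanU1 // dim_lpreim. Qed.

(* The space M of the introduction. *)
Definition common_span (Q : {set T}) g : {vspace dhomog n.+1 K (d + k)} :=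
  (\sum_(i in Q) mul_lfun (g i) @: syz i (Q :\ i) g)%VS.

Lemma common_spanP (Q : {set T}) g v : reflect
  (exists2 h : T -> dhomog n.+1 K k, v = \sum_(i in Q) form_mul (g i) (h i)
     & forall i, i \in Q -> h i \in syz i (Q :\ i) g)
  (v \in common_span Q g).
Proof.
apply: (iffP memv_sumP) => [[vs vsP ->]|[h -> hP]].
  have ex i : exists h : dhomog n.+1 K k, i \in Q ->
      vs i = form_mul (g i) h /\ h \in syz i (Q :\ i) g.
    case: (boolP (i \in Q)) => iQ; last by exists 0.
    by have /memv_imgP [h hs ->] := vsP i iQ; exists h; rewrite lfunE.
  have [h hP] := fin_all_exists ex.
  by exists h => [|i iQ]; [apply: eq_bigr => i iQ |]; case: (hP i iQ).
exists (fun i => form_mul (g i) (h i)) => // i iQ.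
by rewrite -[form_mul _ _]lfunE memv_img // hP.
Qed.

Lemma common_span_ext (Q : {set T}) g g' :
  {in Q, g =1 g'} -> common_span Q g = common_span Q g'.
Proof.
move=> e; apply: eq_bigr => i iQ; rewrite /syz e //; congr (_ @: (_ @^-1: _))%VS.
by apply: form_span_ext => j /setD1P [_ /e].
Qed.

Lemma lin_change_common_span (Q : {set T}) g A v : v \in common_span Q g ->
  lin_change A v \in common_span Q (fun i => lin_change A (g i)).
Proof.
case/common_spanP => h -> hP; rewrite linear_sum; apply/common_spanP.
exists (fun i => lin_change A (h i)) => [|i iQ].
  by apply: eq_bigr => i _; apply: lin_change_form_mul.
rewrite mem_syz -lin_change_form_mul; apply: lin_change_form_span.
by rewrite -mem_syz hP.
Qed.

End FormSpan.

(** * Generic tuples in an orbit *)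

Lemma exists_maximum (T : Type) (F : T -> nat) (N : nat) (x0 : T) :
  (forall x, F x <= N)%N -> exists x, forall y, (F y <= F x)%N.
Proof.
move=> FN; apply: NNPP => nmax.
have H m : exists x, (m <= F x)%N.
  elim: m => [|m [x mx]]; first by exists x0.
  apply: NNPP => nm; apply: nmax; exists x => y.
  by rewrite leqNgt; apply/negP => xy; apply: nm; exists y; apply: leq_ltn_trans xy.
by have [x] := H N.+1; rewrite leqNgt ltnS FN.
Qed.

Section Generic.
Variables (K : closedFieldType) (n d k : nat).
Variable f : dhomog n.+1 K d.

Definition orbit_span (T : finType) (J : {set T}) (A : {ffun T -> 'M[K]_n.+1}) :=
  form_span k J (fun i => lin_change (A i) f).

Lemma line_open_dim (T : finType) (J : {set T}) (r : nat) :
  line_open (fun A : {ffun T -> 'M[K]_n.+1} => r <= \dim (orbit_span J A))%N.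
Proof.
move=> A B /dim_minor [x [w [xV nz]]].
have /fin_all_exists [h hP] a : exists h : T -> dhomog n.+1 K k,
    x a = \sum_(i in J) form_mul (lin_change (A i) f) (h i) by apply/form_spanP.
pose y (C : {ffun T -> 'M[K]_n.+1}) a :=
  \sum_(i in J) form_mul (lin_change (C i) f) (h a i).
pose F C := \det (\matrix_(a, b) (w b (y C a) : K)).
have oF : line_open (fun C => F C != 0).
  apply: line_open_neq0 => C1 C2; apply: polyfun_det => a b.
  suff [P hP'] : polyfun (fun t => \sum_(i in J)
      (w b (form_mul (lin_change ((C1 + t *: C2) i) f) (h a i)) : K)).
    by exists P => t; rewrite mxE linear_sum hP'.
  apply: polyfun_sum => i; apply: polyfun_dhomog.
  have [P hP'] := lin_subst_curve (C1 i) (C2 i) (val f).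
  exists (P * (val (h a i))%:P) => t.
  by rewrite hornerM hornerC -hP' /= !ffunE.
have FA : F A != 0.
  rewrite /F; rewrite (_ : \matrix_(a, b) _ = \matrix_(a, b) (w b (x a) : K)) //.
  by apply/matrixP => a b; rewrite !mxE hP.
have [P P0 hP'] := oF A B FA; exists P => // t ht.
apply/dim_minor; exists (y (A + t *: B)), w; split; last exact: hP'.
by move=> a; apply/form_spanP; exists (h a).
Qed.

(* [b j] is the dimension spanned in degree [d + k] by j generic forms of the
   orbit of f. *)
Variable b : nat -> nat.
Hypothesis b_max : forall j (A : {ffun 'I_j -> 'M[K]_n.+1}),
  (\dim (orbit_span setT A) <= b j)%N.
Hypothesis b_att : forall j, exists A : {ffun 'I_j -> 'M[K]_n.+1},
  \dim (orbit_span setT A) = b j.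

Let s := \dim {: dhomog n.+1 K k}.

Lemma dim_orbit_span_le (T : finType) (J : {set T}) (A : {ffun T -> 'M[K]_n.+1}) :
  (\dim (orbit_span J A) <= b #|J|)%N.
Proof.
rewrite /orbit_span form_span_enum.
apply: leq_trans (b_max [ffun i => A (enum_val i)]).
apply: eq_leq; congr (\dim _).
by apply: form_span_ext => i _; rewrite ffunE.
Qed.

Definition good (T : finType) (A : {ffun T -> 'M[K]_n.+1}) : Prop :=
  forall J : {set T}, (b #|J| <= \dim (orbit_span J A))%N.

Lemma line_open_good (T : finType) : line_open (@good T).
Proof. by apply: line_open_all => J; apply: line_open_dim. Qed.

Lemma exists_good (T : finType) : exists A : {ffun T -> 'M[K]_n.+1}, good A.
Proof.
apply: line_open_meet_all => J; first exact: line_open_dim.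
have [B <-] := b_att #|J|.
exists [ffun x => if [pick i : 'I_#|J| | enum_val i == x] is Some i then B i else 0].
rewrite /orbit_span [X in (_ <= \dim X)%N]form_span_enum.
apply: eq_leq; congr (\dim _); apply: form_span_ext => i _; rewrite ffunE.
case: pickP => [j /eqP /enum_val_inj -> //|/(_ i)].
by rewrite eqxx.
Qed.

Section Good.
Variables (T : finType) (A : {ffun T -> 'M[K]_n.+1}).
Hypothesis gA : good A.
Implicit Types J Q : {set T}.
Let g i := lin_change (A i) f.

Lemma dim_good J : \dim (form_span k J g) = b #|J|.
Proof. by apply/eqP; rewrite eqn_leq dim_orbit_span_le gA. Qed.

Lemma dim_good_syz i J : i \notin J ->
  (\dim (syz k i J g) + b #|J|.+1 = s + b #|J|)%N.
Proof.
move=> iJ; have := dim_syz k g iJ; rewrite !dim_good cardsU1 iJ.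
by rewrite add1n.
Qed.

Variable p : nat.
Hypothesis tight : (b p.+2 + b p = b p.+1 + b p.+1)%N.

Lemma good_syzU i l J : #|J| = p -> i \notin J -> l \notin J -> i != l ->
  syz k i (l |: J) g = syz k i J g.
Proof.
move=> cJ iJ lJ il; apply/esym/eqP; rewrite eqEdim syzS ?subsetUr //=.
have ilJ : i \notin l |: J by rewrite !inE negb_or il.
have := dim_good_syz iJ; have := dim_good_syz ilJ.
by rewrite cardsU1 lJ cJ add1n; lia.
Qed.

Lemma good_syz_eq i J J' : #|J| = p -> #|J'| = p -> i \notin J -> i \notin J' ->
  syz k i J g = syz k i J' g.
Proof.
have [m] := ubnP #|J :\: J'|; elim: m J => // m IHm J lem cJ cJ' iJ iJ'.
have [|[x]] := set_0Vmem (J :\: J').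
  move/eqP; rewrite setD_eq0 => JJ'.
  by suff -> : J = J' by []; apply/eqP; rewrite eqEcard JJ' cJ cJ' leqnn.
rewrite inE => /andP [xJ' xJ].
have [y] : exists y, y \in J' :\: J.
  apply/set0Pn; rewrite setD_eq0; apply: contra xJ' => J'J.
  by suff -> : J' = J by []; apply/eqP; rewrite eqEcard J'J cJ cJ' leqnn.
rewrite inE => /andP [yJ yJ'].
have iy : i != y by apply: contraNneq iJ' => ->.
have ix : i != x by apply: contraNneq iJ => ->.
have xy : x != y by apply: contraNneq xJ' => ->.
pose J1 := y |: (J :\ x).
have cJ1 : #|J1| = p.
  by rewrite cardsU1 !inE (negPf yJ) andbF /= -cJ (cardsD1 x J) xJ.
have iJ1 : i \notin J1 by rewrite !inE negb_or iy (negPf iJ) andbF.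
have xJ1 : x \notin J1 by rewrite !inE negb_or xy eqxx.
rewrite -(good_syzU cJ iJ yJ iy).
have -> : y |: J = x |: J1.
  apply/setP => u; rewrite !inE; case: (u =P x) => [->|_]; rewrite ?xJ ?orbT //.
rewrite (good_syzU cJ1 iJ1 xJ1 ix); apply: IHm => //.
rewrite -ltnS; apply: leq_trans lem; rewrite ltnS.
apply: proper_card; apply/properP; split.
  apply/subsetP => u; rewrite !inE => /andP [uJ' /orP [/eqP uy|/andP [_ ->]]].
    by rewrite uy yJ' in uJ'.
  by rewrite uJ'.
by exists x; rewrite !inE ?xJ ?(negPf xJ') //= (negPf xy) eqxx.
Qed.

Lemma common_span_sub Q Q' : #|Q| = p.+1 -> #|Q'| = p.+1 -> [disjoint Q & Q'] ->
  (common_span k Q' g <= common_span k Q g)%VS.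
Proof.
move=> cQ cQ' dQ; apply/subv_sumP => i iQ'.
have iQ : i \notin Q by apply: contraTN iQ' => iQ; rewrite (disjointFr dQ).
have [x xQ] : exists x, x \in Q by apply/card_gt0P; rewrite cQ.
have cD (R : {set T}) y : #|R| = p.+1 -> y \in R -> #|R :\ y| = p.
  by move=> cR yR; move: cR; rewrite (cardsD1 y) yR => -[].
rewrite (@good_syz_eq i _ (Q :\ x)) ?cD ?inE ?eqxx ?(negPf iQ) ?andbF //.
apply/subvP => v /memv_imgP [h]; rewrite mem_syz lfunE /= => /form_spanP [u hu] ->.
rewrite hu; apply/common_spanP.
exists (fun l => if l == x then 0 else u l).
  rewrite [RHS](big_setD1 x xQ) /= eqxx linear0 add0r; apply: eq_bigr => l.
  by rewrite !inE => /andP [/negPf ->].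
move=> l lQ; case: eqVneq => [_|lx]; first exact: mem0v.
have il : i != l by apply: contraNneq iQ => ->.
have -> : syz k l (Q :\ l) g = syz k l (i |: ((Q :\ x) :\ l)) g.
  apply: good_syz_eq; rewrite ?cD ?inE ?eqxx ?negb_or ?[l == i]eq_sym ?il //.
  rewrite cardsU1 !inE (negPf iQ) !andbF /=.
  by move: (cD _ _ cQ xQ); rewrite (cardsD1 l) !inE lx lQ.
rewrite mem_syz.
have -> : form_mul (g l) (u l) = form_mul (g i) h -
    \sum_(j in (Q :\ x) :\ l) form_mul (g j) (u j).
  by rewrite hu (big_setD1 l) ?addrK //= !inE lx lQ.
apply: rpredB; first by apply: form_span_mul; rewrite !inE eqxx.
by apply: rpred_sum => j jQ; apply: form_span_mul; rewrite !inE;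
   move: jQ; rewrite !inE orbC => ->.
Qed.

Lemma common_span_eq Q Q' : #|Q| = p.+1 -> #|Q'| = p.+1 -> [disjoint Q & Q'] ->
  common_span k Q' g = common_span k Q g.
Proof.
move=> cQ cQ' dQ; apply/eqP; rewrite eqEsubv !common_span_sub //.
by rewrite disjoint_sym.
Qed.

End Good.
End Generic.

Lemma common_span_le (K : fieldType) (n d k : nat) (T : finType) (Q : {set T})
    (g : T -> dhomog n.+1 K d) x :
  (common_span k Q g <= form_span k (Q :\ x) g)%VS.
Proof.
apply/subvP => v /common_spanP [h -> hP]; apply: rpred_sum => i iQ.
have [e|ix] := eqVneq i x; first by rewrite -mem_syz -e hP.
by apply: form_span_mul; rewrite !inE ix.
Qed.

Lemma dhomog_eq0 (K : fieldType) (n d : nat) (g : dhomog n K d) :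
  (g == 0) = (val g == 0).
Proof. by apply/eqP/eqP => [->|g0] //; apply: val_inj. Qed.

Lemma form_mul_eq0 (K : fieldType) (n d k : nat) (g : dhomog n K d) (h : dhomog n K k) :
  (form_mul g h == 0) = (g == 0) || (h == 0).
Proof. by rewrite !dhomog_eq0 val_form_mul mulf_eq0. Qed.

Section Gap.
Variables (K : closedFieldType) (n d k : nat).
Variable f : dhomog n.+1 K d.
Variable b : nat -> nat.
Hypothesis b_max : forall j (A : {ffun 'I_j -> 'M[K]_n.+1}),
  (\dim (orbit_span k f setT A) <= b j)%N.
Hypothesis b_att : forall j, exists A : {ffun 'I_j -> 'M[K]_n.+1},
  \dim (orbit_span k f setT A) = b j.

Let s := \dim {: dhomog n.+1 K k}.
Let N := \dim {: dhomog n.+1 K (d + k)}.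

Lemma generic_dim0 : b 0 = 0%N.
Proof.
have [A <-] := b_att 0; rewrite /orbit_span /form_span big1 ?dimv0 //.
by case.
Qed.

Lemma generic_dim_le j : (b j <= N)%N.
Proof. by have [A <-] := b_att j; apply: dimvS; apply: subvf. Qed.

Lemma ord_max_setC j : ord_max \notin [set~ (ord_max : 'I_j.+1)].
Proof. by rewrite !inE eqxx. Qed.

Lemma generic_dim_step j : (b j <= b j.+1 <= b j + s)%N.
Proof.
have [A gA] := exists_good b_att 'I_j.+1.
pose g (i : 'I_j.+1) := lin_change (A i) f.
have cJ : #|[set~ (ord_max : 'I_j.+1)]| = j by rewrite cardsC1 card_ord.
have e : (\dim (syz k ord_max [set~ ord_max] g) + b j.+1 = s + b j)%N.
  by have := dim_good_syz b_max gA (ord_max_setC j); rewrite cJ.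
have le_s : (\dim (syz k ord_max [set~ ord_max] g) <= s)%N by apply/dimvS/subvf.
have le_b : (b j <= b j.+1)%N.
  have := dimvS (form_spanS k g (subsetT [set~ ord_max])).
  by rewrite !(dim_good b_max gA) cJ cardsT card_ord.
by apply/andP; split; lia.
Qed.

Lemma generic_dim_concave j : (b j.+2 + b j <= b j.+1 + b j.+1)%N.
Proof.
have [A gA] := exists_good b_att 'I_j.+2.
pose g (i : 'I_j.+2) := lin_change (A i) f.
pose J : {set 'I_j.+2} := [set~ ord_max] :\ ord0.
have J0 : ord_max \notin J by rewrite !inE eqxx andbF.
have cC : #|[set~ (ord_max : 'I_j.+2)]| = j.+1 by rewrite cardsC1 card_ord.
have cJ : #|J| = j.
  by move: cC; rewrite (cardsD1 ord0) !inE => -[].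
have e1 : (\dim (syz k ord_max J g) + b j.+1 = s + b j)%N.
  by have := dim_good_syz b_max gA J0; rewrite cJ.
have e2 : (\dim (syz k ord_max [set~ ord_max] g) + b j.+2 = s + b j.+1)%N.
  by have := dim_good_syz b_max gA (ord_max_setC j.+1); rewrite cC.
have le : (\dim (syz k ord_max J g) <= \dim (syz k ord_max [set~ ord_max] g))%N.
  by apply/dimvS/syzS/subD1set.
by lia.
Qed.

Hypothesis charK : [pchar K] =i pred0.
Hypothesis f0 : f != 0.

Lemma gap p : (b p.+2 + b p = b p.+1 + b p.+1)%N -> (b p.+1 < b p + s)%N ->
  b p = N.
Proof.
move=> tight lts.
pose T : finType := (bool * 'I_p.+1)%type.
pose Q c : {set T} := [set x | x.1 == c].
have cQ c : #|Q c| = p.+1.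
  have inj : injective (pair c : 'I_p.+1 -> T) by move=> i j [].
  rewrite -[RHS]card_ord -(card_imset predT inj).
  apply: eq_card => -[c' i]; rewrite !inE; apply/eqP/imsetP => [/= ->|[j _ [-> _]] //].
  by exists i.
have dQ : [disjoint Q false & Q true].
  by rewrite disjoints_subset; apply/subsetP => -[[] i]; rewrite !inE.
pose g (A : {ffun T -> 'M[K]_n.+1}) i := lin_change (A i) f.
have [A0 gA0] := exists_good b_att T.
pose V := common_span k (Q false) (g A0).
pose x0 : T := (false, ord0).
have x0Q : x0 \in Q false by rewrite inE.
have cQx : #|Q false :\ x0| = p by have := cQ false; rewrite (cardsD1 x0) x0Q => -[].
have b1 : (0 < b 1)%N.
  apply: leq_trans (b_max [ffun _ : 'I_1 => 1%:M]).
  rewrite lt0n dimv_eq0; apply/eqP => W0.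
  have [h h0] : exists h : dhomog n.+1 K k, h != 0.
    exists (vpick {: dhomog n.+1 K k}); rewrite vpick0 -dimv_eq0 -/s.
    by apply: contraTneq lts => ->; rewrite addn0 -leqNgt; have /andP [] := generic_dim_step p.
  have := form_span_mul (fun i => lin_change ([ffun _ : 'I_1 => 1%:M] i) f) h (in_setT ord0).
  rewrite -/(orbit_span k f setT _) W0 memv0 form_mul_eq0 (negPf h0) orbF ffunE lin_change1.
  by apply/negP.
have V0 : V != 0%VS.
  apply/eqP => V0.
  have syz0 : syz k x0 (Q false :\ x0) (g A0) != 0%VS.
    have := dim_good_syz b_max gA0 (negbT (setD11 x0 (Q false))).
    by rewrite cQx -dimv_eq0 -/(g A0) -/s; lia.
  rewrite -vpick0 in syz0; have hs := memv_pick (syz k x0 (Q false :\ x0) (g A0)).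
  set h := vpick _ in syz0 hs.
  have : form_mul (g A0 x0) h \in V.
    apply: (subvP (sumv_sup x0 x0Q (subvv _))).
    by rewrite -[form_mul _ _]lfunE memv_img.
  rewrite V0 memv0 form_mul_eq0 (negPf syz0) orbF => /eqP g0.
  have := dim_good b_max gA0 [set x0]; rewrite cards1 /form_span big_set1 -/(g A0 x0) g0.
  suff -> : mul_lfun k (0 : dhomog n.+1 K d) = 0.
    by rewrite lim0g dimv0 => e; rewrite -e in b1.
  by apply/lfunP => u; rewrite lfunE zero_lfunE; apply/eqP; rewrite form_mul_eq0 eqxx.
pose glue (A : {ffun T -> 'M[K]_n.+1}) : {ffun T -> 'M[K]_n.+1} :=
  [ffun x => if x.1 then A x else A0 x].
pose act (phi : 'M[K]_n.+1) (A : {ffun T -> 'M[K]_n.+1}) : {ffun T -> 'M[K]_n.+1} :=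
  [ffun x => A x *m phi].
have VE (A : {ffun T -> 'M[K]_n.+1}) : good k f b (glue A) ->
    common_span k (Q true) (g A) = V.
  move=> gA; rewrite [V](_ : _ = common_span k (Q false) (g (glue A))); last first.
    by apply: common_span_ext => -[c i]; rewrite inE /= /g ffunE => /eqP /= ->.
  rewrite -(common_span_eq b_max gA tight (cQ false) (cQ true) dQ).
  by apply: common_span_ext => -[c i]; rewrite inE /= /g ffunE => /eqP /= ->.
have V_inv (phi : 'M[K]_n.+1) v : phi \in unitmx -> v \in V -> lin_change phi v \in V.
  move=> uphi vV.
  have o1 : line_open (fun A => good k f b (glue A)).
    pose lin B : {ffun T -> 'M[K]_n.+1} := [ffun x => if x.1 then B x else 0].
    apply: (@line_open_affine _ _ _ glue lin); last exact: line_open_good.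
    move=> A t B; apply/ffunP => x; rewrite !ffunE.
    by case: x.1; rewrite // scaler0 addr0.
  have o2 : line_open (fun A => good k f b (glue (act phi A))).
    apply: (@line_open_affine _ _ _ (act phi) (act phi)
      (fun B => good k f b (glue B))) => // A t B.
    by apply/ffunP => x; rewrite !ffunE mulmxDl scalemxAl.
  have glue0 : glue A0 = A0 by apply/ffunP => x; rewrite ffunE if_same.
  have [||A [gA1 gA2]] := line_open_meet o1 o2.
  - by exists A0; rewrite glue0.
  - exists (act (invmx phi) A0).
    suff -> : act phi (act (invmx phi) A0) = A0 by rewrite glue0.
    by apply/ffunP => x; rewrite !ffunE mulmxKV.
  rewrite -(VE _ gA1) in vV; rewrite -(VE _ gA2).
  have := lin_change_common_span phi vV.
  suff -> : common_span k (Q true) (g (act phi A)) =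
      common_span k (Q true) (fun i => lin_change phi (g A i)) by [].
  by apply: common_span_ext => i _; rewrite /g ffunE lin_change_mul.
have Vf := inv_full V_inv charK V0.
apply/eqP; rewrite eqn_leq -{1}cQx -(dim_good b_max gA0) dimvS ?subvf //=.
rewrite -cQx -(dim_good b_max gA0) /N -Vf; apply: dimvS; exact: common_span_le.
Qed.

End Gap.

Section GapSequence.
Variables (s N : nat) (b : nat -> nat).
Hypothesis b_mono : forall j, (b j <= b j.+1)%N.
Hypothesis b_le : forall j, (b j <= N)%N.
Hypothesis b_step : forall j, (b j.+1 <= b j + s)%N.
Hypothesis b_conc : forall j, (b j.+2 + b j <= b j.+1 + b j.+1)%N.
Hypothesis b_gap : forall j, (b j.+2 + b j = b j.+1 + b j.+1)%N ->
  (b j.+1 < b j + s)%N -> b j = N.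

Lemma gap_drop a j : (b j.+1 <= b j + a)%N -> (a < s)%N -> b (j + a) = N.
Proof.
elim: a j => [|a IHa] j hj las.
  by rewrite addn0; apply: b_gap; have := b_mono j; have := b_mono j.+1; have := b_conc j; lia.
have full i : b i = N -> b i.+1 = N by have := b_mono i; have := b_le i.+1; lia.
have [le|lt] := leqP (b j.+1) (b j + a).
  by rewrite addnS; apply/full/IHa => //; apply: ltnW.
rewrite addnS -addSn; have [le|lt'] := leqP (b j.+2) (b j.+1 + a).
  by apply: IHa => //; apply: ltnW.
have bj : b j = N by apply: b_gap; have := b_conc j; lia.
rewrite addSnnS; elim: a.+1 => [|i IHi]; first by rewrite addn0.
by rewrite addnS; apply: full.
Qed.

Hypothesis s0 : (0 < s)%N.
Hypothesis b0 : b 0 = 0%N.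

Lemma gap_linear z : b z = (z * s)%N \/ exists2 j, (j < z)%N & b (j + s.-1) = N.
Proof.
elim: z => [|z [bz|[j jz bj]]]; first by left.
  have [le|lt] := leqP (b z.+1) (b z + s.-1).
    by right; exists z => //; apply: gap_drop; rewrite // prednK.
  by left; rewrite mulSn -bz; have := b_step z; lia.
by right; exists j => //; apply: ltnW.
Qed.

Lemma gap_bound j : (b j <= j * s)%N.
Proof. by elim: j => [|j IHj]; rewrite ?b0 // mulSn; have := b_step j; lia. Qed.

Lemma gap_few z : (z * s + s * s <= N)%N -> b z = (z * s)%N.
Proof.
move=> h; have [//|[j jz bj]] := gap_linear z.
by have := gap_bound (j + s.-1); rewrite bj; nia.
Qed.

Lemma gap_many z : (N + s * s <= z * s)%N -> b z = N.
Proof.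
move=> h; have sz : (s <= z)%N.
  by rewrite -(leq_pmul2r s0); apply: leq_trans h; apply: leq_addl.
have [e|[j jz bj]] := gap_linear (z - s).+1.
  by have := b_le (z - s).+1; rewrite e; nia.
have bmon i m : (b i <= b (i + m))%N.
  by elim: m => [|m IHm]; rewrite ?addn0 // addnS; apply: leq_trans IHm (b_mono _).
have := bmon (j + s.-1)%N (z - (j + s.-1))%N; have := b_le z.
by rewrite subnKC ?bj; lia.
Qed.

End GapSequence.

(** * The ideal generated by a tuple of forms *)

Lemma dimSE (K : fieldType) (n m : nat) : dimS K n m = 'C(m + n, m).
Proof. by rewrite /dimS dimvf. Qed.

Lemma dimS_gt0 (K : fieldType) (n m : nat) : (0 < dimS K n m)%N.
Proof. by rewrite dimSE bin_gt0 leq_addr. Qed.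

Lemma exists_orbit_tuple (K : closedFieldType) (charK : [pchar K] =i pred0)
    (n d k z : nat) (f : dhomog n.+1 K d) : f != 0 ->
  (z * dimS K n k + dimS K n k * dimS K n k <= dimS K n (d + k) \/
   dimS K n (d + k) + dimS K n k * dimS K n k <= z * dimS K n k)%N ->
  exists A : {ffun 'I_z -> 'M[K]_n.+1},
    (minn (z * dimS K n k) (dimS K n (d + k)) <= \dim (orbit_span k f setT A))%N.
Proof.
move=> f0 zP.
have ex j : exists m, (forall A : {ffun 'I_j -> 'M[K]_n.+1},
    \dim (orbit_span k f setT A) <= m)%N /\
    exists A : {ffun 'I_j -> 'M[K]_n.+1}, \dim (orbit_span k f setT A) = m.
  have [A hA] := @exists_maximum _ (fun A : {ffun 'I_j -> 'M[K]_n.+1} =>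
    \dim (orbit_span k f setT A)) _ 0 (fun A => dimvS (subvf _)).
  by exists (\dim (orbit_span k f setT A)); split=> //; exists A.
pose b j := proj1_sig (constructive_indefinite_description _ (ex j)).
have b_max j A : (\dim (@orbit_span K n d k f 'I_j setT A) <= b j)%N.
  by rewrite /b; case: constructive_indefinite_description => m [].
have b_att j : exists A, \dim (@orbit_span K n d k f 'I_j setT A) = b j.
  by rewrite /b; case: constructive_indefinite_description => m [].
have s0 := dimS_gt0 K n k.
have b_mono j : (b j <= b j.+1)%N by have /andP [] := generic_dim_step b_max b_att j.
have b_step j : (b j.+1 <= b j + dimS K n k)%N.
  by have /andP [] := generic_dim_step b_max b_att j.
have b0 := generic_dim0 b_att.
have b_le := generic_dim_le b_att.
have b_conc := generic_dim_concave b_max b_att.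
have b_gap := gap b_max b_att charK f0.
have [A hA] := b_att z; exists A; rewrite hA.
case: zP => zP.
  by rewrite (gap_few b_mono b_le b_step b_conc b_gap s0 b0 zP) geq_minl.
by rewrite (gap_many b_mono b_le b_step b_conc b_gap s0 b0 zP) geq_minr.
Qed.

Lemma pihomogM (K : fieldType) (n d m : nat) (q p : {mpoly K[n]}) : p \is d.-homog ->
  pihomog mdeg m (q * p) = if (d <= m)%N then pihomog mdeg (m - d) q * p else 0.
Proof.
move=> hp; pose M := maxn (mmeasure mdeg q) (m - d).+1.
have qE : q = \sum_(e < M) pihomog mdeg e q by apply: pihomog_partitionE; apply: leq_maxl.
have hom (e : 'I_M) : pihomog mdeg e q * p \is (e + d).-homog.
  by apply: dhomogM => //; apply: pihomogP.
rewrite {1}qE mulr_suml linear_sum /=; case: leqP => dm; last first.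
  rewrite big1 // => e _; apply: pihomog_ne0 (hom e).
  by apply: contraTneq dm => <-; rewrite -leqNgt leq_addl.
have eM : (m - d < M)%N by rewrite leq_max ltnSn orbT.
rewrite (bigD1 (Ordinal eM)) //= pihomog_dE; last first.
  by have := hom (Ordinal eM); rewrite /= subnK.
rewrite big1 ?addr0 // => e ne; apply: pihomog_ne0 (hom e).
apply: contraNneq ne => em; rewrite -val_eqE /=.
by apply/eqP; rewrite -em addnK.
Qed.

Section Ideal.
Variables (K : fieldType) (n d z : nat) (F : 'I_z -> dhomog n.+1 K d).

Lemma form_span_ideal k (p : dhomog n.+1 K (d + k)) :
  p \in form_span k setT F <-> in_ideal (fun i => val (F i)) (val p).
Proof.
split=> [/form_spanP [h ->]|[q hq]].
  exists (fun i => val (h i)); rewrite linear_sum /= big_mkcond /=.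
  by apply: eq_bigr => i _; rewrite in_setT mulrC.
apply/form_spanP; exists (fun i => DHomog (pihomogP mdeg k (q i))).
apply: val_inj; rewrite -(pihomog_dE (dhomog_is_dhomog p)) hq !linear_sum /=.
rewrite [RHS]big_mkcond; apply: eq_bigr => i _.
by rewrite in_setT (pihomogM _ _ (dhomog_is_dhomog (F i))) leq_addr addKn mulrC.
Qed.

Lemma HF_form_span k : HF (fun i => val (F i)) (d + k) = \dim (form_span k setT F).
Proof.
congr (\dim _); apply/vspaceP => p; apply/idP/idP.
  by move/mem_ideal_comp/form_span_ideal.
by move/form_span_ideal/mem_ideal_comp.
Qed.

Lemma HF_lt m : (m < d)%N -> HF (fun i => val (F i)) m = 0%N.
Proof.
move=> md; apply/eqP; rewrite /HF dimv_eq0 -subv0; apply/subvP => p.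
move/mem_ideal_comp => [q hq]; rewrite memv0 dhomog_eq0.
rewrite -(pihomog_dE (dhomog_is_dhomog p)) hq linear_sum /= big1 // => i _.
by rewrite (pihomogM _ _ (dhomog_is_dhomog (F i))) leqNgt md.
Qed.

Lemma form_span_full_S k :
  form_span k setT F = fullv -> form_span k.+1 setT F = fullv.
Proof.
move=> full; apply: dhomog_full => v a va.
have [f aE] : exists f : {ffun 'I_(d + k).+1 -> 'I_n.+1}, a = (\sum_j U_(f j))%MM.
  apply: exists_content; rewrite -addnS.
  by apply: (dhomog_mf (dhomog_is_dhomog v)); rewrite va msuppX inE.
pose a' := (\sum_j U_(f (lift ord0 j)))%MM : 'X_{1..n.+1}.
have da' : mdeg a' = (d + k)%N.
  by rewrite mdeg_sum (eq_bigr (fun=> 1%N)) ?sum1_card ?card_ord // => j _; rewrite mdeg1.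
have : monomial K (d + k) a' \in form_span k setT F by rewrite full memvf.
move/form_span_ideal; rewrite val_monomial // => -[q hq].
apply/form_span_ideal; exists (fun i => 'X_(f ord0) * q i).
rewrite va aE big_ord_recl mpolyXD -/a' hq mulr_sumr.
by apply: eq_bigr => i _; rewrite mulrA.
Qed.

Lemma form_span_full_le k r : (r <= k)%N ->
  form_span r setT F = fullv -> form_span k setT F = fullv.
Proof.
move=> /subnK <- full; elim: (k - r)%N => // j IHj.
exact: form_span_full_S.
Qed.

Definition syzygy_map k (h : {ffun 'I_z -> dhomog n.+1 K k}) : dhomog n.+1 K (d + k) :=
  \sum_i form_mul (F i) (h i).

Lemma syzygy_map_is_linear k : linear (@syzygy_map k).
Proof.
move=> c h1 h2; rewrite /syzygy_map scaler_sumr -big_split; apply: eq_bigr => i _.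
by rewrite !ffunE linearP.
Qed.

HB.instance Definition _ k :=
  GRing.isLinear.Build K {ffun 'I_z -> dhomog n.+1 K k} (dhomog n.+1 K (d + k)) _
    (@syzygy_map k) (@syzygy_map_is_linear k).

Lemma form_span_injP k : reflect (injective (@syzygy_map k))
  (\dim (form_span k setT F) == z * dimS K n k)%N.
Proof.
pose u : 'Hom({ffun 'I_z -> dhomog n.+1 K k}, dhomog n.+1 K (d + k)) :=
  linfun (@syzygy_map k).
have uE : limg u = form_span k setT F.
  apply/vspaceP => v; apply/memv_imgP/form_spanP => [[h _ ->]|[h ->]].
    exists h; rewrite lfunE /= /syzygy_map [RHS]big_mkcond /=.
    by apply: eq_bigr => i _; rewrite in_setT.
  exists [ffun i => h i]; rewrite ?memvf // lfunE /= /syzygy_map big_mkcond /=.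
  by apply: eq_bigr => i _; rewrite in_setT ffunE.
have dimE : \dim {: {ffun 'I_z -> dhomog n.+1 K k}} = (z * dimS K n k)%N.
  by rewrite /dimS !dimvf -[in RHS](card_ord z).
have := limg_ker_dim u fullv; rewrite capfv uE dimE => e.
have -> : (\dim (form_span k setT F) == z * dimS K n k)%N = (lker u == 0%VS).
  by rewrite -dimv_eq0 -e -{1}[\dim (form_span k setT F)]add0n eqn_add2r eq_sym.
apply: (iffP idP) => [/lker0P inj h1 h2|inj]; first by have := inj h1 h2; rewrite !lfunE.
by apply/lker0P => h1 h2; rewrite !lfunE; apply: inj.
Qed.

Lemma form_span_inj_le k r : (k <= r)%N ->
  \dim (form_span r setT F) = (z * dimS K n r)%N ->
  \dim (form_span k setT F) = (z * dimS K n k)%N.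
Proof.
move=> kr /eqP /form_span_injP injr; apply/eqP/form_span_injP.
suff ker0 h : syzygy_map (h : {ffun 'I_z -> dhomog n.+1 K k}) = 0 -> h = 0.
  by move=> h1 h2 e; apply/eqP; rewrite -subr_eq0; apply/eqP/ker0; rewrite linearB /= e subrr.
move=> h0; pose X : {mpoly K[n.+1]} := 'X_ord0 ^+ (r - k).
have hX : X \is (r - k).-homog.
  rewrite -[(r - k)%N]mul1n; apply: dhomogMn; rewrite dhomogX; apply/eqP; exact: mdeg1.
have hom i : val (h i) * X \is r.-homog.
  by rewrite -(subnKC kr); exact: (dhomogM (dhomog_is_dhomog (h i)) hX).
have : [ffun i => DHomog (hom i)] = 0 :> {ffun 'I_z -> dhomog n.+1 K r}.
  apply: injr; rewrite linear0; apply/eqP; rewrite dhomog_eq0 linear_sum /=; apply/eqP.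
  transitivity (val (syzygy_map h) * X); last by rewrite h0 mul0r.
  by rewrite linear_sum /= mulr_suml; apply: eq_bigr => i _; rewrite ffunE /= mulrA.
move/ffunP => hX0; apply/ffunP => i; have := congr1 val (hX0 i).
rewrite !ffunE /= => /eqP; rewrite mulf_eq0 => /orP [/eqP|].
  by move=> e; apply: val_inj.
by rewrite expf_eq0 => /andP [_ /eqP] /(congr1 (mcoeff U_(ord0)));
   rewrite mcoeffX eqxx mcoeff0 => /eqP; rewrite oner_eq0.
Qed.

End Ideal.

Lemma form_mul_suml (K : fieldType) (n d k : nat) (I : finType) (x : I -> K)
    (g : I -> dhomog n K d) (h : dhomog n K k) :
  form_mul (\sum_c x c *: g c) h = \sum_c x c *: form_mul (g c) h.
Proof.
apply: val_inj; rewrite /= !linear_sum /= mulr_suml.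
by apply: eq_bigr => c _; rewrite -scalerAl.
Qed.

Lemma zariski_open_neq0 (K : fieldType) (vT : vectType K) (U : vT -> Prop)
    (J : {mpoly K[\dim {: vT}]} -> Prop) :
  (forall v, U v <-> exists2 P, J P & P.@[fun i => coord (vbasis {: vT}) i v] != 0) ->
  zariski_open U.
Proof.
move=> UJ; exists J => v; split=> [nU P JP|J0 /UJ [P /J0 -> /eqP //]].
by apply/eqP/negPn/negP => nz; apply/nU/UJ; exists P.
Qed.

Lemma form_span_minors (K : fieldType) (n d z k r : nat)
    (vT := {ffun 'I_z -> dhomog n.+1 K d}) :
  exists J : {mpoly K[\dim {: vT}]} -> Prop, forall F : vT,
    (r <= \dim (form_span k setT F))%N <->
    exists2 P, J P & P.@[fun i => coord (vbasis {: vT}) i F] != 0.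
Proof.
pose e := vbasis {: vT}.
pose M (h : 'I_r -> 'I_z -> dhomog n.+1 K k)
    (w : 'I_r -> 'Hom(dhomog n.+1 K (d + k), K^o)) :=
  \matrix_(a, b) \sum_(c < \dim {: vT})
    (w b (\sum_i form_mul ((e`_c : vT) i) (h a i)) : K) *:
    ('X_c : {mpoly K[\dim {: vT}]}).
have ME h w (F : vT) : (\det (M h w)).@[fun i => coord e i F] =
    \det (\matrix_(a, b) (w b (\sum_i form_mul (F i) (h a i)) : K)).
  rewrite -det_map_mx; congr (\det _); apply/matrixP => a b; rewrite !mxE [LHS]linear_sum.
  have FE i : F i = \sum_c coord e c F *: (e`_c : vT) i.
    rewrite {1}(coord_vbasis (memvf F)) sum_ffunE.
    by apply: eq_bigr => c _; rewrite ffunE.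
  have -> : \sum_i form_mul (F i) (h a i) =
      \sum_c coord e c F *: \sum_i form_mul ((e`_c : vT) i) (h a i).
    under [LHS]eq_bigr => i _ do rewrite FE form_mul_suml.
    by rewrite exchange_big; apply: eq_bigr => c _; rewrite scaler_sumr.
  rewrite [RHS]linear_sum; apply: eq_bigr => c _.
  by rewrite /= mevalZ mevalXU linearZ mulrC.
exists (fun P => exists h w, P = \det (M h w)) => F; split.
  case/dim_minor => [x [w [xV nz]]].
  have /fin_all_exists [h hP] a : exists h : 'I_z -> dhomog n.+1 K k,
      x a = \sum_(i in setT) form_mul (F i) (h i) by apply/form_spanP.
  exists (\det (M h w)); first by exists h, w.
  rewrite ME; congr (\det _ != 0): nz; apply/matrixP => a b; rewrite !mxE hP.
  by congr (w b _); apply: eq_bigl => i; rewrite in_setT.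
case=> _ [h [w ->]]; rewrite ME => nz.
apply/dim_minor; exists (fun a => \sum_i form_mul (F i) (h a i)), w; split=> // a.
by apply/form_spanP; exists (h a); apply: eq_bigl => i; rewrite in_setT.
Qed.

Lemma zariski_open_form_span2 (K : fieldType) (n d z k1 r1 k2 r2 : nat) :
  zariski_open (fun F : {ffun 'I_z -> dhomog n.+1 K d} =>
    (r1 <= \dim (form_span k1 setT F))%N /\ (r2 <= \dim (form_span k2 setT F))%N).
Proof.
have [J1 J1P] := form_span_minors K n d z k1 r1.
have [J2 J2P] := form_span_minors K n d z k2 r2.
apply: (@zariski_open_neq0 _ _ _ (fun P => exists P1 P2, [/\ J1 P1, J2 P2 & P = P1 * P2])).
move=> F; split=> [[/J1P [P1 JP1 nz1] /J2P [P2 JP2 nz2]]|[_ [P1 [P2 [JP1 JP2 ->]]]]].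
  by exists (P1 * P2); [exists P1, P2 | rewrite mevalM mulf_neq0].
rewrite mevalM mulf_eq0 negb_or => /andP [nz1 nz2].
by split; [apply/J1P; exists P1 | apply/J2P; exists P2].
Qed.

Section GenericForms.
Variables (K : closedFieldType) (n d z r : nat).
Hypothesis charK : [pchar K] =i pred0.
Variable D : dhomog n.+1 K d -> Prop.
Hypothesis D_nz : exists2 f, D f & f != 0.
Hypothesis D_closed : closed_lin_change D.

Local Notation s k := (dimS K n k).

Hypothesis few : (z * s r + s r * s r <= s (d + r))%N.
Hypothesis many : (s (d + r.+1) + s r.+1 * s r.+1 <= z * s r.+1)%N.

Let U (F : {ffun 'I_z -> dhomog n.+1 K d}) : Prop :=
  (z * s r <= \dim (form_span r setT F))%N /\
  (s (d + r.+1) <= \dim (form_span r.+1 setT F))%N.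

Lemma exists_generic_tuple :
  exists F : {ffun 'I_z -> dhomog n.+1 K d}, (forall i, D (F i)) /\ U F.
Proof.
have [f Df f0] := D_nz.
have [A1 hA1] := exists_orbit_tuple charK (k := r) f0 (or_introl few).
have [A2 hA2] := exists_orbit_tuple charK (k := r.+1) f0 (or_intror many).
have o1 := @line_open_dim K n d r f 'I_z setT (z * s r).
have o2 := @line_open_dim K n d r.+1 f 'I_z setT (s (d + r.+1)).
have o3 : line_open (fun A : {ffun 'I_z -> 'M[K]_n.+1} => forall i, \det (A i) != 0).
  apply: line_open_all => i.
  apply: (@line_open_neq0 _ _ (fun A : {ffun 'I_z -> 'M[K]_n.+1} => \det (A i))).
  move=> A B; apply: polyfun_det => a b; exists ((A i a b)%:P + (B i a b) *: 'X) => t.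
  by rewrite hornerD hornerZ hornerC hornerX !ffunE !mxE mulrC.
have [||A12 hA12] := line_open_meet o1 o2.
- by exists A1; apply: leq_trans hA1; rewrite leq_min leqnn /=; lia.
- by exists A2; apply: leq_trans hA2; rewrite leq_min leqnn andbT; lia.
have [||A [[h1 h2] h3]] := line_open_meet (line_openI o1 o2) o3.
- by exists A12.
- by exists [ffun=> 1%:M] => i; rewrite ffunE det1 oner_neq0.
exists [ffun i => lin_change (A i) f]; split=> [i|].
  by rewrite ffunE; apply: D_closed; rewrite // unitmxE unitfE.
have e k : form_span k setT [ffun i => lin_change (A i) f] = orbit_span k f setT A.
  by apply: form_span_ext => i _; rewrite ffunE.
by rewrite /U !e.
Qed.

Lemma generic_HF F k : U F ->
  HF (fun i => val (F i)) (d + k) = (if (k <= r)%N then z * s k else s (d + k))%N.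
Proof.
case=> h1 h2; rewrite HF_form_span; case: leqP => kr.
  apply: (form_span_inj_le kr); apply/eqP; rewrite eqn_leq h1 andbT.
  by apply: leq_trans (dim_form_span _ _ _) _; rewrite cardsT card_ord.
rewrite (form_span_full_le kr) //.
by apply/eqP; rewrite eqEdim subvf.
Qed.

Lemma generic_dimS k :
  if (k <= r)%N then (z * s k <= s (d + k))%N else (s (d + k) <= z * s k)%N.
Proof.
have [F [_ UF]] := exists_generic_tuple; have := generic_HF k UF.
rewrite HF_form_span; case: leqP => kr <-; first by apply/dimvS/subvf.
by apply: leq_trans (dim_form_span _ _ _) _; rewrite cardsT card_ord.
Qed.

Lemma generic_forms_HF : generic_forms (z := z) D (fun F => forall m,
  HF (fun i => val (F i)) m =
  if (m < d)%N then 0%N else minn (z * s (m - d)) (s m)).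
Proof.
exists U; split; [exact: zariski_open_form_span2 | exact: exists_generic_tuple |].
move=> F _ UF m; case: leqP => [dm|]; last exact: HF_lt.
rewrite -{1 3}(subnKC dm) (generic_HF _ UF); have := generic_dimS (m - d).
by case: ifP => _ h; [rewrite (minn_idPl h) | rewrite (minn_idPr h)].
Qed.

End GenericForms.

(** * Expansions of rational functions *)

Section Expansion.
Variable R : fieldType.
Implicit Types p q : {poly R}.

Definition eq_upto (M : nat) p q : Prop := forall m, (m < M)%N -> p`_m = q`_m.

Lemma eq_upto_trans M q p p' : eq_upto M p q -> eq_upto M q p' -> eq_upto M p p'.
Proof. by move=> h1 h2 m mM; rewrite h1 ?h2. Qed.

Lemma eq_uptoM M q p p' : eq_upto M p p' -> eq_upto M (q * p) (q * p').
Proof.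
move=> h m mM; rewrite !coefM; apply: eq_bigr => i _; rewrite h //.
by apply: leq_ltn_trans mM; apply: leq_subr.
Qed.

Lemma expansion_unique M p q (a : series R) : q`_0 != 0 ->
  eq_upto M (q * \poly_(i < M) a i) p ->
  forall m, (m < M)%N -> expansion p q m = a m.
Proof.
move=> q0 h m; have [k] := ubnP m; elim: k m => // k IHk m mk mM.
have E : \sum_(i < m) q`_(m - i) * expansion p q i =
    \sum_(i < m) q`_(m - i) * (\poly_(i < M) a i)`_i.
  apply: eq_bigr => i _; have iM := ltn_trans (ltn_ord i) mM.
  by rewrite coef_poly iM IHk //; exact: leq_trans (ltn_ord i) mk.
have := expansionP p m q0; rewrite -(h m mM) coefMr !big_ord_recr /= subnn E.
by move=> /addrI /(mulfI q0) ->; rewrite coef_poly mM.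
Qed.

Lemma coef_mul1BX p m : ((1 - 'X) * p)`_m = p`_m - (if m is m'.+1 then p`_m' else 0).
Proof. by rewrite mulrBl mul1r coefB coefXM; case: m. Qed.

Lemma geometric_power n M :
  eq_upto M ((1 - 'X) ^+ n.+1 * \poly_(i < M) ('C(i + n, i))%:R) (1 : {poly R}).
Proof.
elim: n => [|n IHn] m mM.
  rewrite expr1 coef_mul1BX coef1 coef_poly mM addn0 binn.
  by case: m mM => [|m] mM; rewrite ?subr0 // coef_poly (ltnW mM) addn0 binn subrr.
rewrite exprSr -mulrA; apply: eq_upto_trans IHn m mM; apply: eq_uptoM => m mM.
rewrite coef_mul1BX !coef_poly mM; case: m mM => [|m] mM.
  by rewrite subr0 !bin0.
by rewrite coef_poly (ltnW mM) addnS binS natrD addSnnS addrK.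
Qed.

Lemma coef0_1BX n : ((1 - 'X : {poly R}) ^+ n)`_0 != 0.
Proof.
by rewrite -horner_coef0 horner_exp hornerD hornerN hornerX hornerC subr0 expr1n oner_neq0.
Qed.

Lemma expansion_geometric n m :
  expansion 1 ((1 - 'X) ^+ n.+1) m = ('C(m + n, m))%:R :> R.
Proof.
apply: (@expansion_unique m.+1 _ _ (fun i => ('C(i + n, i))%:R)) => //; last first.
  exact: geometric_power.
exact: coef0_1BX.
Qed.

Lemma one_sub_Xd_exp d z : exists Q,
  (1 - 'X^d) ^+ z = 1 - z%:R *: 'X^d + 'X^(d + d) * Q :> {poly R}.
Proof.
elim: z => [|z [Q hQ]]; first by exists 0; rewrite expr0 scale0r subr0 mulr0 addr0.
exists (Q * (1 - 'X^d) + z%:R%:P).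
rewrite exprSr hQ -[z.+1]addn1 natrD -!mul_polyC polyCD exprD.
ring.
Qed.

Lemma expansion_numerator n d z m : (m < d + d)%N ->
  expansion ((1 - 'X^d) ^+ z) ((1 - 'X) ^+ n.+1) m =
  ('C(m + n, m))%:R - (if (m < d)%N then 0 else (z * 'C(m - d + n, m - d))%:R) :> R.
Proof.
pose a i : R := ('C(i + n, i))%:R -
  (if (i < d)%N then 0 else (z * 'C(i - d + n, i - d))%:R).
move: m; apply: (@expansion_unique (d + d) _ _ a).
  exact: coef0_1BX.
pose A : {poly R} := \poly_(i < d + d) ('C(i + n, i))%:R.
have aE : eq_upto (d + d) (\poly_(i < d + d) a i) ((1 - z%:R *: 'X^d) * A).
  move=> m mM; rewrite mulrBl mul1r coefB -scalerAl coefZ coefXnM !coef_poly mM /a.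
  case: ltnP => dm; first by rewrite mulr0.
  by rewrite (leq_ltn_trans (leq_subr _ _) mM) natrM.
apply: eq_upto_trans (eq_uptoM _ aE) _; rewrite mulrCA.
apply: (eq_upto_trans (eq_uptoM (1 - z%:R *: 'X^d) (@geometric_power n (d + d)))).
have [Q ->] := one_sub_Xd_exp d z; rewrite mulr1 => m mM.
by rewrite [RHS]coefD coefXnM mM addr0.
Qed.

End Expansion.

Lemma dimS_mono (K : fieldType) (n k m : nat) :
  (k <= m)%N -> (dimS K n k <= dimS K n m)%N.
Proof.
move=> km; rewrite !dimSE.
rewrite -[X in (X <= _)%N](@bin_sub (k + n) k) ?leq_addr // addKn.
rewrite -[X in (_ <= X)%N](@bin_sub (m + n) m) ?leq_addr // addKn.
by apply: leq_bin2l; rewrite leq_add2r.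
Qed.

Theorem proposition2 (K : closedFieldType) (charK : [pchar K] =i pred0)
    (n d z : nat) (hd : (0 < d)%N) (hz : (0 < z)%N)
    (D : dhomog n.+1 K d -> Prop)
    (D_nz : exists2 f, D f & f != 0)
    (D_closed : closed_lin_change D)
    (hr : exists r : nat,
       (dimS K n (d + r + 1))%:R / (dimS K n (r + 1))%:R + (dimS K n (r + 1))%:R
         <= (z%:R : rat)
         <= (dimS K n (d + r))%:R / (dimS K n r)%:R - (dimS K n r)%:R) :
  let expected : series rat :=
    shift d (fun k => (minn (z * dimS K n k) (dimS K n (d + k)))%:R) in
  generic_forms (z := z) D (fun f => HS (fun i => val (f i)) =1 expected)
  /\ expected =1
     (fun m => expansion 1 ((1 - 'X) ^+ n.+1) m
               - truncate (expansion ((1 - 'X^d) ^+ z) ((1 - 'X) ^+ n.+1)) m).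
Proof.
move=> expected; case: hr => r; rewrite -addnA addn1 => /andP [lo hi].
have s0 k : 0 < (dimS K n k)%:R :> rat by rewrite ltr0n dimS_gt0.
have few : (z * dimS K n r + dimS K n r * dimS K n r <= dimS K n (d + r))%N.
  move: hi; rewrite lerBrDr ler_pdivlMr // -natrD -natrM ler_nat mulnDl.
  by [].
have many : (dimS K n (d + r.+1) + dimS K n r.+1 * dimS K n r.+1 <= z * dimS K n r.+1)%N.
  move: lo; rewrite -lerBrDr ler_pdivrMr // mulrBl lerBrDr -!natrM -natrD ler_nat.
  by [].
have dims := generic_dimS charK D_nz D_closed few many.
have rd : (r.+1 < d)%N.
  rewrite ltnNge; apply/negP => /(dimS_mono K n).
  have := dims 0%N; rewrite addn0 [dimS K n 0]dimSE bin0 muln1 /=.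
  have := dimS_gt0 K n (d + r.+1); have := dimS_gt0 K n r.+1.
  by move: many; nia.
split.
  have [U [oU nU UP]] := generic_forms_HF charK D_nz D_closed few many.
  exists U; split=> // f Df Uf m; rewrite /HS UP // /expected /shift.
  by case: ltnP => // dm; rewrite subnKC.
have e2 m : (m < d + d)%N -> expansion ((1 - 'X^d) ^+ z) ((1 - 'X) ^+ n.+1) m =
    (dimS K n m)%:R - (if (m < d)%N then 0 else (z * dimS K n (m - d))%:R) :> rat.
  by move=> mM; rewrite expansion_numerator // !dimSE.
move=> m; rewrite expansion_geometric -(dimSE K) /truncate /expected /shift.
case: (leqP m (d + r)) => mr.
  have -> : [forall i : 'I_m.+1,
      0 <= expansion ((1 - 'X^d) ^+ z) ((1 - 'X) ^+ n.+1) i :> rat].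
    apply/forallP => i; have im := ltn_ord i; rewrite e2; last by lia.
    case: ltnP => di; first by rewrite subr0 ler0n.
    rewrite subr_ge0 ler_nat; have := dims (i - d)%N; rewrite subnKC //.
    by rewrite leq_subLR; case: leqP => //; lia.
  rewrite e2; last by lia.
  rewrite opprB addrC subrK; case: ltnP => // dm; congr (_%:R).
  have := dims (m - d)%N; rewrite subnKC // leq_subLR mr => h.
  exact/minn_idPl.
have -> : [forall i : 'I_m.+1,
    0 <= expansion ((1 - 'X^d) ^+ z) ((1 - 'X) ^+ n.+1) i :> rat] = false.
  apply/negbTE/forallPn; have dr : (d + r.+1 < m.+1)%N by lia.
  exists (Ordinal dr); rewrite /= e2; last by lia.
  rewrite ltnNge leq_addr /= addKn subr_ge0 ler_nat -ltnNge.
  by apply: leq_trans many; rewrite -addn1 leq_add2l muln_gt0 dimS_gt0.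
rewrite subr0; have dm : (d <= m)%N by lia.
rewrite ltnNge dm /= subnKC //; congr (_%:R).
have := dims (m - d)%N; rewrite subnKC // leq_subLR leqNgt mr /= => h.
exact/minn_idPr.
Qed.
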